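(* There exists an absolute constant $c>0$ such that for every $n\geqslant 3$, every centered convex body $K$ in $\mathbb{R}^n$ and every pair of orthogonal unit vectors $u,v\in\mathbb{R}^n$, setting $E_{uv}=(\mathrm{span}\{u,v\})^{\perp}$, $$|K\cap u^{\perp}|\,|K\cap v^{\perp}|\leqslant c\,|K\cap E_{uv}|\,|K|.$$ *)

(* Defs.v *)
(* real numbers from Stdlib Reals.
   Volumes are defined as Jordan content (limits of normalized lattice-point
   counts), which coincides with Lebesgue measure on convex bodies. *)
From Stdlib Require Import Reals Lra Lia ClassicalEpsilon.
Open Scope R_scope.

(* Points of R^n are functions nat -> R; a point "lies in R^n" when all
   coordinates of index >= n vanish. *)
Definition Vec := nat -> R.

Definition supp (n : nat) (x : Vec) : Prop := forall j, (n <= j)%nat -> x j = 0.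

Fixpoint rsum (m : nat) (g : nat -> R) : R :=
  match m with O => 0 | S m' => rsum m' g + g m' end.

Definition dot (n : nat) (x y : Vec) : R := rsum n (fun i => x i * y i).

Definition norm (n : nat) (x : Vec) : R := sqrt (dot n x x).

Definition dist (n : nat) (x y : Vec) : R := norm n (fun i => x i - y i).

Definition unit_vec (n : nat) (u : Vec) : Prop := supp n u /\ dot n u u = 1.

Definition orthonormal (n k : nat) (b : nat -> Vec) : Prop :=
  (forall i, (i < k)%nat -> supp n (b i)) /\
  (forall i j, (i < k)%nat -> (j < k)%nat ->
     dot n (b i) (b j) = if Nat.eqb i j then 1 else 0).

Definition lincomb (k : nat) (b : nat -> Vec) (t : Vec) : Vec :=
  fun j => rsum k (fun i => t i * b i j).

Definition convex_set (n : nat) (K : Vec -> Prop) : Prop :=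
  forall x y t, K x -> K y -> 0 <= t <= 1 ->
    K (fun i => t * x i + (1 - t) * y i).

Definition closed_set (n : nat) (K : Vec -> Prop) : Prop :=
  forall x, supp n x ->
    (forall eps, 0 < eps -> exists y, K y /\ dist n x y < eps) -> K x.

Definition bounded_set (n : nat) (K : Vec -> Prop) : Prop :=
  exists B, forall x, K x -> norm n x <= B.

Definition nonempty_interior (n : nat) (K : Vec -> Prop) : Prop :=
  exists x r, 0 < r /\ supp n x /\
    forall y, supp n y -> dist n x y < r -> K y.

Definition convex_body (n : nat) (K : Vec -> Prop) : Prop :=
  (forall x, K x -> supp n x) /\ convex_set n K /\ closed_set n K /\
  bounded_set n K /\ nonempty_interior n K.

Definition ind (S : Vec -> Prop) (x : Vec) : R :=
  if excluded_middle_informative (S x) then 1 else 0.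

Definition upd (x : Vec) (k : nat) (r : R) : Vec :=
  fun i => if Nat.eqb i k then r else x i.

Fixpoint gridsum (k L : nat) (f : Vec -> R) : R :=
  match k with
  | O => f (fun _ => 0)
  | S k' => rsum (2 * L + 1)
              (fun j => gridsum k' L (fun x => f (upd x k' (INR j - INR L))))
  end.

(* is_int k S f v : the integral over S (a bounded subset of R^k, given in
   the first k coordinates) of f equals v, computed as the limit of Riemann
   sums over the lattice (1/(N+1)) Z^k. *)
Definition is_int (k : nat) (S : Vec -> Prop) (f : Vec -> R) (v : R) : Prop :=
  exists B : nat,
    (forall x, S x -> forall i, (i < k)%nat -> Rabs (x i) <= INR B) /\
    Un_cv (fun N =>
      gridsum k (B * (N + 1))
        (fun z => let x := fun i => z i / INR (N + 1) in ind S x * f x)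
      / (INR (N + 1)) ^ k) v.

Definition is_vol (k : nat) (S : Vec -> Prop) (v : R) : Prop :=
  is_int k S (fun _ => 1) v.

Definition centered (n : nat) (K : Vec -> Prop) : Prop :=
  forall j, (j < n)%nat -> is_int n K (fun x => x j) 0.

(* volume of the section of K by the k-dimensional subspace spanned by the
   orthonormal family b 0, ..., b (k-1), in the intrinsic coordinates of
   that subspace *)
Definition section_vol (k : nat) (b : nat -> Vec) (K : Vec -> Prop) (v : R) : Prop :=
  is_vol k (fun t => K (lincomb k b t)) v.

(* Main.v *)
Require Import Defs.
From Stdlib Require Import Reals.
From Stdlib Require Import Lra Lia List FunctionalExtensionality ClassicalEpsilon Classical_Prop.
Import Defs ListNotations.
Open Scope R_scope.

(* Write F(s,t) for the (n-2)-volume of K intersected with E_uv + s u + t v.  By the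
   Brunn-Minkowski inequality F is log-concave on the plane, and its centroid is the origin.
   Midpoint log-concavity gives F(s/2,t/2) >= sqrt(F(s,0) F(0,t)) >= F(s,0) F(0,t) / max, where
   the maximum is over the two axes; integrating over the plane,
     4 |K| >= |K cap u^perp| |K cap v^perp| / max.
   It remains to see that max F <= e^8 F(0,0), which follows from Jensen's inequality for ln F.

   Volumes of convex sets are computed as iterated integrals of quasi-concave functions: each
   one-dimensional integral differs from its Riemann sums by at most (mesh) * (maximum), so the
   Jordan content of a convex set in a box is approximated by lattice-point counts uniformly over
   all such sets.  Independence of the orthonormal basis is obtained by double counting pairs of
   nearby points of the two lattices. *)

(** * Finite sums and lattice points *)

(** Centeredness is given only through lattice sums along the standard axes, and F may jump at the
    boundary of its support. So neither a moment of F nor F ln F is ever integrated: Jensen's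
    inequality is applied to finite Riemann sums, whose centroid is merely close to the origin. The
    defect is repaired by a neighbourhood of the origin on which F >= [e0] > 0: the origin is a
    convex combination of the discrete centroid and of a point of that neighbourhood, the weight of
    the latter being as small as desired. The neighbourhood exists because the origin is interior to
    K, which must itself be deduced from centeredness. The exponent 8 is 2 * 4. The 2 comes from u
    <= 2 exp (u / 2) with u = ln (F p / F), and the 4 is the Jacobian of halving both plane
    variables, which also gives the factor 4 of the final constant [4 * exp 8]. Moments as well as
    volumes have to be transported to a basis adapted to u and v; for this the double counting of
    lattice points is carried out with a Lipschitz weight [psi], constant for volumes and a linear
    functional for moments. *)

Definition lsum {A : Type} (l : list A) (f : A -> R) : R :=
  fold_right (fun x s => f x + s) 0 l.

Lemma lsum_cons A (a : A) l f : lsum (a :: l) f = f a + lsum l f.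
Proof. reflexivity. Qed.

Lemma lsum_1 A (a : A) f : lsum [a] f = f a.
Proof. apply Rplus_0_r. Qed.

Lemma lsum_ext A (l : list A) f g :
  (forall x, In x l -> f x = g x) -> lsum l f = lsum l g.
Proof.
induction l as [|a l IH]; simpl; intros H; [reflexivity|].
rewrite H by tauto. rewrite IH; [reflexivity | intros; apply H; tauto].
Qed.

Lemma lsum_le A (l : list A) f g :
  (forall x, In x l -> f x <= g x) -> lsum l f <= lsum l g.
Proof.
induction l as [|a l IH]; simpl; intros H; [lra|].
assert (f a <= g a) by (apply H; tauto).
assert (lsum l f <= lsum l g) by (apply IH; intros; apply H; tauto). lra.
Qed.

Lemma lsum_plus A (l : list A) f g : lsum l (fun x => f x + g x) = lsum l f + lsum l g.
Proof. induction l as [|a l IH]; simpl; [lra | rewrite IH; lra]. Qed.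

Lemma lsum_scal A (l : list A) c f : lsum l (fun x => c * f x) = c * lsum l f.
Proof. induction l as [|a l IH]; simpl; [lra | rewrite IH; lra]. Qed.

Lemma lsum_minus A (l : list A) f g : lsum l (fun x => f x - g x) = lsum l f - lsum l g.
Proof. induction l as [|a l IH]; simpl; [lra | rewrite IH; lra]. Qed.

Lemma lsum_const A (l : list A) c : lsum l (fun _ => c) = INR (length l) * c.
Proof.
induction l as [|a l IH]; [simpl; lra|].
simpl length. rewrite S_INR. simpl. rewrite IH. lra.
Qed.

Lemma lsum_zero A (l : list A) f : (forall x, In x l -> f x = 0) -> lsum l f = 0.
Proof. intros H. rewrite (lsum_ext _ _ f (fun _ => 0)) by assumption. rewrite lsum_const. lra. Qed.

Lemma lsum_nonneg A (l : list A) f : (forall x, In x l -> 0 <= f x) -> 0 <= lsum l f.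
Proof. intros H. rewrite <- (lsum_zero A l (fun _ => 0)) by auto. apply lsum_le; assumption. Qed.

Lemma lsum_abs A (l : list A) f : Rabs (lsum l f) <= lsum l (fun x => Rabs (f x)).
Proof.
induction l as [|a l IH]; simpl; [rewrite Rabs_R0; lra|].
eapply Rle_trans; [apply Rabs_triang | lra].
Qed.

Lemma lsum_app A (l l' : list A) f : lsum (l ++ l') f = lsum l f + lsum l' f.
Proof. induction l as [|a l IH]; simpl; [lra | rewrite IH; lra]. Qed.

Lemma lsum_map A B (g : A -> B) l f : lsum (map g l) f = lsum l (fun x => f (g x)).
Proof. induction l as [|a l IH]; simpl; [reflexivity | rewrite IH; reflexivity]. Qed.

Lemma lsum_flat_map A B (g : A -> list B) l f :
  lsum (flat_map g l) f = lsum l (fun x => lsum (g x) f).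
Proof. induction l as [|a l IH]; simpl; [reflexivity | rewrite lsum_app, IH; reflexivity]. Qed.

Lemma lsum_swap A B (l : list A) (l' : list B) f :
  lsum l (fun x => lsum l' (fun y => f x y)) = lsum l' (fun y => lsum l (fun x => f x y)).
Proof.
induction l as [|a l IH]; simpl.
- rewrite lsum_zero; auto.
- rewrite IH, lsum_plus. reflexivity.
Qed.

(* Taking the total weight as one of the components turns this into closure under averages. *)
Lemma lsum_cone A I (P : (I -> R) -> Prop) (l : list A) (f : A -> I -> R) :
  P (fun _ => 0) -> (forall a b, P a -> P b -> P (fun i => a i + b i)) ->
  (forall x, In x l -> P (f x)) -> P (fun i => lsum l (fun x => f x i)).
Proof.
intros P0 Padd. induction l as [|a l IH]; simpl; intros H; [exact P0|].
apply Padd; [apply H; tauto | apply IH; intros; apply H; tauto].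
Qed.

Lemma rsum_lsum m g : rsum m g = lsum (seq 0 m) g.
Proof.
induction m as [|m IH]; [reflexivity|].
rewrite seq_S, lsum_app, lsum_1. simpl. rewrite IH. lra.
Qed.

(** The centre [c] is kept general so that an affine change of variable maps one list of sample
    points exactly onto another, as [qint_affine] requires. *)
Definition pts (c h : R) (L : nat) : list R :=
  map (fun j => c + h * (INR j - INR L)) (seq 0 (2 * L + 1)).

Fixpoint grid (k L : nat) (h : R) : list Vec :=
  match k with
  | O => [fun _ => 0]
  | S k' => flat_map (fun s => map (fun x => upd x k' s) (grid k' L h)) (pts 0 h L)
  end.

Lemma length_pts c h L : length (pts c h L) = (2 * L + 1)%nat.
Proof. unfold pts. rewrite length_map, length_seq. reflexivity. Qed.

Lemma pts_bound h L s : 0 <= h -> In s (pts 0 h L) -> Rabs s <= h * INR L.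
Proof.
intros Hh Hs. apply in_map_iff in Hs. destruct Hs as [j [<- Hj]].
apply in_seq in Hj.
assert (H1 := pos_INR j).
assert (H2 : INR j <= 2 * INR L).
{ replace 2 with (INR 2) by (simpl; lra). rewrite <- mult_INR. apply le_INR. lia. }
rewrite Rplus_0_l, Rabs_mult, (Rabs_pos_eq h) by assumption.
apply Rmult_le_compat_l; [assumption|]. apply Rabs_le. lra.
Qed.

Lemma lsum_grid_S k L h f :
  lsum (grid (S k) L h) f =
  lsum (pts 0 h L) (fun s => lsum (grid k L h) (fun x => f (upd x k s))).
Proof.
simpl. rewrite lsum_flat_map. apply lsum_ext. intros s _. apply lsum_map.
Qed.

Lemma gridsum_grid k L h f :
  gridsum k L (fun z => f (fun i => h * z i)) = lsum (grid k L h) f.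
Proof.
revert f. induction k as [|k IH]; intros f.
- simpl. rewrite Rplus_0_r. f_equal. extensionality i. lra.
- rewrite lsum_grid_S. simpl gridsum. rewrite rsum_lsum. unfold pts. rewrite lsum_map.
  replace (L + (L + 0) + 1)%nat with (2 * L + 1)%nat by lia.
  apply lsum_ext. intros j _. rewrite <- IH. f_equal.
  extensionality z. f_equal. extensionality i. unfold upd.
  destruct (Nat.eqb i k); lra.
Qed.

Lemma grid_in k L h x : 0 <= h -> In x (grid k L h) ->
  supp k x /\ forall i, (i < k)%nat -> Rabs (x i) <= h * INR L.
Proof.
intros Hh. revert x. induction k as [|k IH]; intros x Hx.
- destruct Hx as [<-|[]]. split; [intros j _; reflexivity | intros; lia].
- apply in_flat_map in Hx. destruct Hx as [s [Hs Hx]].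
  apply in_map_iff in Hx. destruct Hx as [y [<- Hy]].
  destruct (IH y Hy) as [Y1 Y2]. apply pts_bound in Hs; [|assumption].
  split.
  + intros j Hj. unfold upd. destruct (Nat.eqb_spec j k); [lia|]. apply Y1. lia.
  + intros i Hi. unfold upd. destruct (Nat.eqb_spec i k); [assumption|]. apply Y2. lia.
Qed.

Lemma length_grid k L h : INR (length (grid k L h)) = (2 * INR L + 1) ^ k.
Proof.
induction k as [|k IH]; [simpl; lra|].
replace (INR (length (grid (S k) L h))) with (lsum (grid (S k) L h) (fun _ => 1))
  by (rewrite lsum_const; lra).
rewrite lsum_grid_S.
rewrite (lsum_ext _ _ _ (fun _ => (2 * INR L + 1) ^ k))
  by (intros; rewrite lsum_const, IH; lra).
rewrite lsum_const, length_pts, plus_INR, mult_INR. simpl. lra.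
Qed.

(** * Layer-cake comparison of weighted sums *)

Definition level (y t : R) : R := if Rle_dec t y then 1 else 0.

Lemma level_count_full q n y : 0 <= q -> INR n * q <= y ->
  lsum (seq 1 n) (fun i => level y (INR i * q)) = INR n.
Proof.
intros Hq Hy. rewrite (lsum_ext _ _ _ (fun _ => 1)).
- rewrite lsum_const, length_seq. lra.
- intros i Hi. apply in_seq in Hi. unfold level. destruct Rle_dec as [|N]; [reflexivity|].
  exfalso. apply N. assert (INR i <= INR n) by (apply le_INR; lia). nra.
Qed.

(** A nonnegative number is recovered up to [q] by counting the positive multiples of [q] below it.
    Stopping at [n] although [y] may reach [(n+1) q] still costs at most [q], and it keeps every
    level used strictly below the maximum. *)
Lemma level_count q n y : 0 <= q -> 0 <= y <= INR (S n) * q ->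
  y - q <= q * lsum (seq 1 n) (fun i => level y (INR i * q)) <= y.
Proof.
intros Hq. induction n as [|n IH]; intros Hy.
- simpl in *. lra.
- destruct (Rle_dec (INR (S n) * q) y) as [H|H].
  + rewrite level_count_full by assumption. rewrite (S_INR (S n)) in Hy. lra.
  + rewrite seq_S, lsum_app, lsum_1.
    replace (level y (INR (1 + n) * q)) with 0.
    * rewrite Rplus_0_r. apply IH. lra.
    * unfold level. destruct Rle_dec; [|reflexivity]. contradiction.
Qed.

Lemma archimed_small (W e : R) : 0 <= W -> 0 < e -> exists N : nat, W / INR (S N) < e.
Proof.
intros HW He. destruct (INR_unbounded (W / e)) as [N HN]. exists N.
rewrite S_INR. assert (0 <= W / e) by (apply Rle_mult_inv_pos; lra).
apply Rmult_lt_reg_r with (INR N + 1); [lra|]. unfold Rdiv. rewrite Rmult_assoc, Rinv_l by lra.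
assert (W = W / e * e) by (field; lra). nra.
Qed.

(* The level [t] ranges over the open interval only, so nothing need be known at the supremum. *)
Lemma layer_cake A (l : list A) (w v : A -> R) (M e : R) :
  0 <= M -> (forall x, In x l -> 0 <= v x <= M) ->
  (forall t, 0 < t < M -> lsum l (fun x => w x * level (v x) t) <= e) ->
  lsum l (fun x => w x * v x) <= e * M.
Proof.
intros HM Hv Ht.
destruct (Req_dec M 0) as [->|HM0].
{ rewrite lsum_zero; [lra|]. intros x Hx. specialize (Hv x Hx).
  replace (v x) with 0 by lra. ring. }
assert (HW : 0 <= lsum l (fun x => Rabs (w x))) by (apply lsum_nonneg; intros; apply Rabs_pos).
set (W := lsum l (fun x => Rabs (w x))) in *.
apply le_epsilon. intros eps Heps.
destruct (archimed_small ((W + Rabs e) * M) eps) as [N HN];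
  [assert (H := Rabs_pos e); nra | assumption |].
set (q := M / INR (S N)) in *.
assert (HSN : 0 < INR (S N)) by (apply lt_0_INR; lia).
assert (Hq : 0 < q) by (apply Rdiv_lt_0_compat; lra).
assert (HqM : INR (S N) * q = M) by (unfold q; field; lra).
(* Each [v x] is replaced by its staircase of step [q]. The sign of [w x] is unknown, so the
   rounding is charged to [Rabs (w x)]. *)
apply Rle_trans with
  (lsum l (fun x => w x * (q * lsum (seq 1 N) (fun i => level (v x) (INR i * q)))
                    + q * Rabs (w x))).
{ apply lsum_le. intros x Hx. specialize (Hv x Hx).
  destruct (level_count q N (v x)) as [H1 H2]; [lra | lra |].
  assert (H3 := Rle_abs (w x)). assert (H4 := Rle_abs (- w x)). rewrite Rabs_Ropp in H4.
  set (y := q * lsum _ _) in *.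
  assert (0 <= (Rabs (w x) - w x) * (v x - y)) by (apply Rmult_le_pos; lra).
  assert (0 <= Rabs (w x) * (q - (v x - y)))
    by (apply Rmult_le_pos; [apply Rabs_pos | lra]). nra. }
rewrite lsum_plus, lsum_scal. fold W.
assert (H : lsum l (fun x => w x * (q * lsum (seq 1 N) (fun i => level (v x) (INR i * q))))
  = q * lsum (seq 1 N) (fun i => lsum l (fun x => w x * level (v x) (INR i * q)))).
{ rewrite lsum_swap, <- lsum_scal. apply lsum_ext. intros x _. rewrite lsum_scal. ring. }
rewrite H.
assert (H5 : lsum (seq 1 N) (fun i => lsum l (fun x => w x * level (v x) (INR i * q)))
  <= INR N * e).
{ replace (INR N) with (INR (length (seq 1 N))) by (now rewrite length_seq).
  rewrite <- lsum_const. apply lsum_le. intros i Hi.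
  apply in_seq in Hi. apply Ht.
  assert (1 <= INR i) by (replace 1 with (INR 1) by reflexivity; apply le_INR; lia).
  assert (INR i < INR (S N)) by (apply lt_INR; lia). split; nra. }
assert (H6 : q * INR N = M - q) by (rewrite S_INR in HqM; lra).
assert (H7 : (W + Rabs e) * M / INR (S N) = (W + Rabs e) * q) by (unfold q; field; lra).
assert (H8 := Rle_abs (- e)). rewrite Rabs_Ropp in H8. nra.
Qed.

(** * Integrals of quasi-concave functions on the line *)

Lemma Rabs_le_inv x a : Rabs x <= a -> - a <= x <= a.
Proof. unfold Rabs. destruct Rcase_abs; lra. Qed.

(** Error bounds here are linear in the mesh [h], so this is how exact inequalities between
    integrals are extracted from Riemann sums. *)
Lemma le_of_small (a b C : R) : (forall h, 0 < h <= 1 -> a <= b + C * h) -> a <= b.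
Proof.
intros H. apply le_epsilon. intros eps He.
assert (HC := Rabs_pos C). assert (HC' := Rle_abs C).
set (d := eps / (eps + Rabs C)).
assert (Hd : 0 < d) by (apply Rdiv_lt_0_compat; lra).
assert (Hd' : d * (eps + Rabs C) = eps) by (unfold d; field; lra).
assert (Hd1 : d <= 1) by nra.
specialize (H d (conj Hd Hd1)). nra.
Qed.

Lemma eq_of_small (a b C : R) : (forall h, 0 < h <= 1 -> Rabs (a - b) <= C * h) -> a = b.
Proof.
intros H. apply Rle_antisym; apply (le_of_small _ _ C); intros h Hh;
  specialize (H h Hh); apply Rabs_le_inv in H; lra.
Qed.

Lemma cover (h B : R) : 0 < h -> exists L : nat, B <= h * INR L.
Proof.
intros Hh. destruct (INR_unbounded (B / h)) as [L HL]. exists L.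
replace B with (h * (B / h)) by (field; lra). apply Rmult_le_compat_l; lra.
Qed.

Definition sum1 (c h : R) (L : nat) (g : R -> R) : R := h * lsum (pts c h L) g.

(** The third clause makes every superlevel set an interval, which is all the regularity needed for
    integration. Continuity would be too much to ask: the section function of a cube jumps at the
    ends of its support. *)
Definition qconcave (B M : R) (g : R -> R) : Prop :=
  (forall x, 0 <= g x <= M) /\ (forall x, g x <> 0 -> Rabs x <= B) /\
  (forall x y z, x <= y <= z -> Rmin (g x) (g z) <= g y).

Lemma level_bound y t : 0 <= level y t <= 1.
Proof. unfold level. destruct Rle_dec; lra. Qed.

(** Induction along the progression: a new point inside [[x, y]] adds [h] to the right side and at
    most [h] to the left, before [x] the left side is negative, and beyond [y] it is constant. *)
Lemma level_interval_lower c0 h g t x y n :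
  0 < h -> c0 <= x -> (forall s, x <= s <= y -> t <= g s) ->
  Rmin y (c0 + h * INR n) - x - h <=
  h * lsum (seq 0 n) (fun j => level (g (c0 + h * INR j)) t).
Proof.
intros Hh Hx Hg. induction n as [|n IH].
- simpl. assert (H := Rmin_r y (c0 + h * 0)). lra.
- rewrite seq_S, lsum_app, lsum_1. simpl (0 + n)%nat. rewrite S_INR.
  assert (Hnn : 0 <= lsum (seq 0 n) (fun j => level (g (c0 + h * INR j)) t))
    by (apply lsum_nonneg; intros; apply level_bound).
  assert (Hb := level_bound (g (c0 + h * INR n)) t).
  set (p := c0 + h * INR n) in *.
  assert (Hm : Rmin y (c0 + h * (INR n + 1)) <= p + h)
    by (eapply Rle_trans; [apply Rmin_r | unfold p; lra]).
  destruct (Rle_dec x p) as [Hxp|]; [|nra].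
  destruct (Rle_dec p y) as [Hpy|].
  + rewrite (Rmin_right y p) in IH by assumption.
    unfold level at 2. destruct (Rle_dec t (g p)) as [|N]; [nra|].
    exfalso; apply N, Hg; lra.
  + rewrite (Rmin_left y p) in IH by lra.
    assert (Hm' := Rmin_l y (c0 + h * (INR n + 1))). nra.
Qed.

Lemma pts_seq c h L f :
  lsum (pts c h L) f = lsum (seq 0 (2 * L + 1)) (fun j => f ((c - h * INR L) + h * INR j)).
Proof. unfold pts. rewrite lsum_map. apply lsum_ext. intros j _. f_equal. ring. Qed.

Lemma cnt_lower c h L g t x y :
  0 < h -> x <= y -> c - h * INR L <= x -> y <= c + h * INR L ->
  (forall s, x <= s <= y -> t <= g s) ->
  y - x - h <= h * lsum (pts c h L) (fun s => level (g s) t).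
Proof.
intros Hh Hxy H1 H2 Hg. rewrite pts_seq.
eapply Rle_trans; [|apply (level_interval_lower (c - h * INR L) h g t x y)]; auto.
rewrite Rmin_left; [lra|].
rewrite plus_INR, mult_INR. simpl. nra.
Qed.

Lemma level_interval_upper (g : nat -> R) t n :
  lsum (seq 0 n) (fun j => level (g j) t) = 0 \/
  exists i j, (i <= j < n)%nat /\ t <= g i /\ t <= g j /\
    lsum (seq 0 n) (fun j => level (g j) t) <= INR j - INR i + 1.
Proof.
induction n as [|n IH]; [left; reflexivity|].
rewrite seq_S, lsum_app, lsum_1. simpl (0 + n)%nat.
unfold level at 2 4. destruct (Rle_dec t (g n)) as [Hn|Hn].
- right. destruct IH as [IH|[i [j [Hij [Hi [Hj IH]]]]]].
  + exists n, n. rewrite IH. repeat split; auto; try lia; lra.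
  + exists i, n. repeat split; auto; try lia.
    assert (INR (S j) <= INR n) by (apply le_INR; lia). rewrite S_INR in H. lra.
- destruct IH as [IH|[i [j [Hij [Hi [Hj IH]]]]]].
  + left; lra.
  + right; exists i, j. repeat split; auto; try lia; lra.
Qed.

(** The sampled points of a superlevel set lie between the first and the last of them, which serve
    as [x] and [y]; a progression of step [h] has at most [(y - x) / h + 1] terms there. *)
Lemma cnt_upper c h L g t : 0 < h ->
  lsum (pts c h L) (fun s => level (g s) t) = 0 \/
  exists x y, x <= y /\ t <= g x /\ t <= g y /\
    h * lsum (pts c h L) (fun s => level (g s) t) <= y - x + h.
Proof.
intros Hh. rewrite pts_seq.
destruct (level_interval_upper (fun j => g (c - h * INR L + h * INR j)) t (2 * L + 1))
  as [H|[i [j [Hij [Hi [Hj H]]]]]]; [left; assumption|].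
right. exists (c - h * INR L + h * INR i), (c - h * INR L + h * INR j).
assert (INR i <= INR j) by (apply le_INR; lia).
repeat split; auto; nra.
Qed.

Lemma qconcave_level B M g t x y : qconcave B M g -> t <= g x -> t <= g y ->
  forall s, x <= s <= y -> t <= g s.
Proof.
intros [_ [_ H]] Hx Hy s Hs. eapply Rle_trans; [|apply (H x s y Hs)].
apply Rmin_glb; assumption.
Qed.

Lemma qconcave_supp B M g t x : qconcave B M g -> 0 < t -> t <= g x -> Rabs x <= B.
Proof. intros [_ [H _]] Ht Hx. apply H. lra. Qed.

Lemma qconcave_M B M g : qconcave B M g -> 0 <= M.
Proof. intros [H _]. specialize (H 0). lra. Qed.

(** At level [t] the first grid sees points spread over some [[x, y]]; by quasi-concavity all of
    [[x, y]] is in the superlevel set, so the second grid sees length at least [y - x - h']. The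
    layer cake integrates this over [t]. Only the second grid has to cover the support. *)
Lemma sum1_compare B M g c h L c' h' L' : qconcave B M g -> 0 < h -> 0 < h' ->
  B + Rabs c' <= h' * INR L' -> sum1 c h L g <= sum1 c' h' L' g + (h + h') * M.
Proof.
intros U Hh Hh' HB.
(* Both sums enter one list with weights [h] and [- h'], so that [layer_cake] bounds their
   difference. *)
set (l := map (fun s => (h, g s)) (pts c h L) ++ map (fun s => (- h', g s)) (pts c' h' L')).
assert (H : lsum l (fun p => fst p * snd p) <= (h + h') * M).
{ apply layer_cake.
  - apply (qconcave_M _ _ _ U).
  - intros p Hp. destruct U as [U _].
    apply in_app_or in Hp. destruct Hp as [Hp|Hp]; apply in_map_iff in Hp;
      destruct Hp as [s [<- _]]; apply U.
  - intros t Ht. unfold l. rewrite lsum_app, !lsum_map. simpl. rewrite !lsum_scal.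
    assert (H0 : 0 <= lsum (pts c' h' L') (fun x => level (g x) t))
      by (apply lsum_nonneg; intros; apply level_bound).
    destruct (cnt_upper c h L g t Hh) as [E|[x [y [Hxy [Hx [Hy E]]]]]].
    + rewrite E. nra.
    + assert (Bx := qconcave_supp _ _ _ _ _ U (proj1 Ht) Hx).
      assert (By := qconcave_supp _ _ _ _ _ U (proj1 Ht) Hy).
      apply Rabs_le_inv in Bx. apply Rabs_le_inv in By.
      assert (Hc := Rle_abs c'). assert (Hc' := Rle_abs (- c')). rewrite Rabs_Ropp in Hc'.
      assert (D : y - x - h' <= h' * lsum (pts c' h' L') (fun s => level (g s) t)).
      { apply cnt_lower; try lra. intros s Hs. apply (qconcave_level _ _ _ _ _ _ U Hx Hy s Hs). }
      lra. }
unfold l in H. rewrite lsum_app, !lsum_map in H. simpl in H. rewrite !lsum_scal in H.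
unfold sum1. lra.
Qed.

(** The mesh is [1 / (N + 1)] and the window [[-(N+1), N+1]] grows, so the definition need not
    mention a bound on the support. When the sums diverge the value is arbitrary. *)
Definition qint (g : R -> R) : R :=
  epsilon (inhabits 0)
    (fun l => Un_cv (fun N => sum1 0 (/ INR (N + 1)) ((N + 1) * (N + 1)) g) l).

Lemma inv_INR_pos N : 0 < / INR (N + 1).
Proof. apply Rinv_0_lt_compat, lt_0_INR. lia. Qed.

Lemma inv_small e : 0 < e -> exists N0, forall N, (N >= N0)%nat -> / INR (N + 1) < e.
Proof.
intros He. destruct (INR_unbounded (/ e)) as [N0 H0]. exists N0. intros N HN.
rewrite <- (Rinv_inv e). apply Rinv_lt_contravar.
- apply Rmult_lt_0_compat; [apply Rinv_0_lt_compat; lra | apply lt_0_INR; lia].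
- eapply Rlt_le_trans; [apply H0 | apply le_INR; lia].
Qed.

Lemma cover_square B : exists N0, forall N, (N >= N0)%nat ->
  B <= / INR (N + 1) * INR ((N + 1) * (N + 1)).
Proof.
destruct (INR_unbounded B) as [N0 H0]. exists N0. intros N HN.
rewrite mult_INR, <- Rmult_assoc, Rinv_l, Rmult_1_l by (apply not_0_INR; lia).
assert (INR N0 <= INR (N + 1)) by (apply le_INR; lia). lra.
Qed.

Lemma qint_cv B M g : qconcave B M g ->
  Un_cv (fun N => sum1 0 (/ INR (N + 1)) ((N + 1) * (N + 1)) g) (qint g).
Proof.
intros U. unfold qint. apply epsilon_spec.
assert (HM := qconcave_M _ _ _ U).
destruct (R_complete (fun N => sum1 0 (/ INR (N + 1)) ((N + 1) * (N + 1)) g)) as [l Hl].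
- intros eps He. destruct (inv_small (eps / (2 * M + 1))) as [N1 H1].
  { apply Rdiv_lt_0_compat; lra. }
  destruct (cover_square B) as [N2 H2].
  exists (max N1 N2). intros n m Hn Hm.
  assert (Dn := H1 n ltac:(lia)). assert (Dm := H1 m ltac:(lia)).
  assert (Pn := inv_INR_pos n). assert (Pm := inv_INR_pos m).
  assert (Cn := H2 n ltac:(lia)). assert (Cm := H2 m ltac:(lia)).
  assert (X1 := sum1_compare B M g 0 _ ((n + 1) * (n + 1)) 0 _ ((m + 1) * (m + 1)) U Pn Pm).
  assert (X2 := sum1_compare B M g 0 _ ((m + 1) * (m + 1)) 0 _ ((n + 1) * (n + 1)) U Pm Pn).
  rewrite Rabs_R0, Rplus_0_r in X1, X2. specialize (X1 Cm). specialize (X2 Cn).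
  assert (E : (/ INR (n + 1) + / INR (m + 1)) * M < eps).
  { assert (eps / (2 * M + 1) * (2 * M + 1) = eps) by (field; lra). nra. }
  unfold Rdist. apply Rabs_def1; lra.
- exists l. exact Hl.
Qed.

(** Letting one of the two meshes tend to 0 in [sum1_compare], used in both directions, leaves the
    error [h * M]. *)
Lemma qint_approx B M g c h L : qconcave B M g -> 0 < h -> B + Rabs c <= h * INR L ->
  Rabs (sum1 c h L g - qint g) <= h * M.
Proof.
intros U Hh HB. assert (HM := qconcave_M _ _ _ U).
assert (HJ := qint_cv _ _ _ U).
assert (K : forall e, 0 < e -> Rabs (sum1 c h L g - qint g) <= h * M + e).
{ intros e He. destruct (HJ (e / 2)) as [N1 H1]; [lra|].
  destruct (inv_small (e / (2 * M + 1))) as [N2 H2]. { apply Rdiv_lt_0_compat; lra. }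
  destruct (cover_square B) as [N3 H3].
  set (n := max N1 (max N2 N3)).
  specialize (H1 n ltac:(lia)). specialize (H2 n ltac:(lia)). specialize (H3 n ltac:(lia)).
  unfold Rdist in H1. apply Rabs_def2 in H1.
  assert (Pn := inv_INR_pos n).
  assert (X1 := sum1_compare B M g 0 _ ((n + 1) * (n + 1)) c h L U Pn Hh HB).
  assert (X2 := sum1_compare B M g c h L 0 _ ((n + 1) * (n + 1)) U Hh Pn).
  rewrite Rabs_R0, Rplus_0_r in X2. specialize (X2 H3).
  assert (E : / INR (n + 1) * M <= e / 2).
  { assert (e / (2 * M + 1) * (2 * M + 1) = e) by (field; lra). nra. }
  apply Rabs_le. lra. }
apply le_epsilon. exact K.
Qed.

Lemma qint_approx0 B M g h L : qconcave B M g -> 0 < h -> B <= h * INR L ->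
  Rabs (sum1 0 h L g - qint g) <= h * M.
Proof. intros U Hh HB. apply (qint_approx B); auto. rewrite Rabs_R0. lra. Qed.

Lemma qint_ext f g : (forall x, f x = g x) -> qint f = qint g.
Proof. intros H. f_equal. extensionality x. apply H. Qed.

Lemma sum1_nonneg c h L g : 0 < h -> (forall x, 0 <= g x) -> 0 <= sum1 c h L g.
Proof. intros Hh Hg. apply Rmult_le_pos; [lra|]. apply lsum_nonneg. auto. Qed.

Lemma qint_nonneg B M g : qconcave B M g -> 0 <= qint g.
Proof.
intros U. apply (le_of_small _ _ M). intros h Hh.
destruct (cover h B) as [L HL]; [lra|].
assert (A1 := qint_approx0 _ _ _ h L U ltac:(lra) ltac:(lra)). apply Rabs_le_inv in A1.
assert (0 <= sum1 0 h L g) by (apply sum1_nonneg; [lra | intros; apply U]). lra.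
Qed.

Lemma qint_lower B M g x y m : qconcave B M g -> x <= y -> 0 <= m ->
  (forall s, x <= s <= y -> m <= g s) -> m * (y - x) <= qint g.
Proof.
(* When [m = 0] nothing places [[x, y]] inside the support, hence inside the grid, so this case is
   treated apart. *)
intros U Hxy Hm H. destruct (Req_dec m 0) as [->|Hm0].
{ rewrite Rmult_0_l. apply (qint_nonneg _ _ _ U). }
apply (le_of_small _ _ (M + m)). intros h Hh.
destruct (cover h B) as [L HL]; [lra|].
assert (A1 := qint_approx0 _ _ _ h L U ltac:(lra) ltac:(lra)). apply Rabs_le_inv in A1.
assert (Bx := qconcave_supp _ _ _ m x U ltac:(lra) (H x ltac:(lra))).
assert (By := qconcave_supp _ _ _ m y U ltac:(lra) (H y ltac:(lra))).
apply Rabs_le_inv in Bx. apply Rabs_le_inv in By.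
assert (C := cnt_lower 0 h L g m x y ltac:(lra) Hxy ltac:(lra) ltac:(lra) H).
assert (D : m * lsum (pts 0 h L) (fun s => level (g s) m) <= lsum (pts 0 h L) g).
{ rewrite <- lsum_scal. apply lsum_le. intros s _. destruct U as [U _].
  specialize (U s). unfold level. destruct Rle_dec; lra. }
unfold sum1 in A1. nra.
Qed.

Lemma qint_upper (B : nat) M g : qconcave (INR B) M g -> qint g <= (2 * INR B + 2) * M.
Proof.
intros U. assert (A := qint_approx0 _ _ _ 1 B U ltac:(lra) ltac:(lra)). apply Rabs_le_inv in A.
unfold sum1 in A.
assert (H : lsum (pts 0 1 B) g <= lsum (pts 0 1 B) (fun _ => M)) by (apply lsum_le; intros; apply U).
rewrite lsum_const, length_pts, plus_INR, mult_INR in H. simpl in H. lra.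
Qed.

Lemma qconcave_affine B M g a l : qconcave B M g -> 0 < l ->
  qconcave ((B + Rabs a) / l) M (fun s => g (a + l * s)).
Proof.
intros [U1 [U2 U3]] Hl. repeat split.
- apply U1.
- apply U1.
- intros x Hx. apply U2 in Hx.
  apply Rmult_le_reg_r with l; [assumption|].
  replace ((B + Rabs a) / l * l) with (B + Rabs a) by (field; lra).
  replace (Rabs x * l) with (Rabs (x * l)) by (rewrite Rabs_mult, (Rabs_pos_eq l); lra).
  replace (x * l) with ((a + l * x) + - a) by ring.
  eapply Rle_trans; [apply Rabs_triang|]. rewrite Rabs_Ropp. lra.
- intros x y z Hxyz. apply U3. nra.
Qed.

(** The grid of mesh [l * h] centred at [a] is the exact image of the grid of mesh [h] centred at 0,
    so the two Riemann sums agree up to the factor [l]. *)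
Lemma qint_affine B M g a l : qconcave B M g -> 0 < l -> qint (fun s => g (a + l * s)) = qint g / l.
Proof.
intros U Hl. assert (U' := qconcave_affine _ _ _ a _ U Hl).
apply (eq_of_small _ _ (2 * M)). intros h Hh.
destruct (cover h ((B + Rabs a) / l)) as [L HL]; [lra|].
assert (A1 := qint_approx0 _ _ _ h L U' ltac:(lra) HL).
assert (HL' : B + Rabs a <= l * h * INR L).
{ replace (B + Rabs a) with (l * ((B + Rabs a) / l)) by (field; lra).
  rewrite Rmult_assoc. apply Rmult_le_compat_l; lra. }
assert (A2 := qint_approx _ _ _ a (l * h) L U ltac:(nra) HL').
apply Rabs_le_inv in A1. apply Rabs_le_inv in A2.
assert (E : sum1 a (l * h) L g = l * sum1 0 h L (fun s => g (a + l * s))).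
{ unfold sum1. rewrite Rmult_assoc. f_equal. f_equal. unfold pts. rewrite !lsum_map.
  apply lsum_ext. intros j _. f_equal. ring. }
rewrite E in A2. set (X := sum1 0 h L _) in *.
assert (D : qint g = l * (qint g / l)) by (field; lra). rewrite D in A2.
set (Y := qint g / l) in *.
assert (X - Y <= h * M) by (apply Rmult_le_reg_l with l; nra).
assert (- (h * M) <= X - Y) by (apply Rmult_le_reg_l with l; nra).
apply Rabs_le. lra.
Qed.

Lemma qconcave_scal B M g c : qconcave B M g -> 0 <= c -> qconcave B (c * M) (fun s => c * g s).
Proof.
intros [U1 [U2 U3]] Hc. repeat split.
- specialize (U1 x). nra.
- specialize (U1 x). nra.
- intros x Hx. apply U2. intros E. apply Hx. rewrite E. ring.
- intros x y z H. specialize (U3 x y z H).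
  unfold Rmin in *. repeat destruct Rle_dec; nra.
Qed.

Lemma qint_scal B M g c : qconcave B M g -> 0 <= c -> qint (fun s => c * g s) = c * qint g.
Proof.
intros U Hc. assert (U' := qconcave_scal _ _ _ _ U Hc).
apply (eq_of_small _ _ (2 * c * M)). intros h Hh.
destruct (cover h B) as [L HL]; [lra|].
assert (A1 := qint_approx0 _ _ _ h L U' ltac:(lra) HL).
assert (A2 := qint_approx0 _ _ _ h L U ltac:(lra) HL).
apply Rabs_le_inv in A1. apply Rabs_le_inv in A2.
assert (E : sum1 0 h L (fun s => c * g s) = c * sum1 0 h L g).
{ unfold sum1. rewrite lsum_scal. ring. }
rewrite E in A1. apply Rabs_le. nra.
Qed.

(** * Prekopa-Leindler and volumes of convex sets *)

(** This is a^l b^(1-l) for positive [a] and [b]. Since [ln] is 0 at nonpositive arguments, the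
    value at 0 is not the expected 0, which is why positivity is assumed wherever log-concavity is
    stated. *)
Definition geomean (l a b : R) : R := exp (l * ln a + (1 - l) * ln b).

Lemma ln_le_sub1 y : 0 < y -> ln y <= y - 1.
Proof. intros H. assert (E := exp_ineq1_le (ln y)). rewrite exp_ln in E; lra. Qed.

Lemma geomean_pos l a b : 0 < geomean l a b.
Proof. apply exp_pos. Qed.

Lemma ln_geomean l a b : ln (geomean l a b) = l * ln a + (1 - l) * ln b.
Proof. apply ln_exp. Qed.

Lemma ln_div x y : 0 < x -> 0 < y -> ln (x / y) = ln x - ln y.
Proof. intros. unfold Rdiv. rewrite ln_mult, ln_Rinv by (auto; apply Rinv_0_lt_compat; auto). lra. Qed.

Lemma ln_le_compat x y : 0 < x -> x <= y -> ln x <= ln y.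
Proof. intros H [H1| ->]; [left; apply ln_increasing; assumption | lra]. Qed.

Lemma exp_le_compat x y : x <= y -> exp x <= exp y.
Proof. intros [H| ->]; [left; apply exp_increasing; assumption | lra]. Qed.

(** Apply [ln y <= y - 1] to [a / m] and [b / m], where [m] is the arithmetic mean: the weighted sum
    of the right sides vanishes. *)
Lemma geomean_amgm l a b : 0 <= l <= 1 -> 0 < a -> 0 < b -> geomean l a b <= l * a + (1 - l) * b.
Proof.
intros Hl Ha Hb. set (m := l * a + (1 - l) * b).
assert (Hm : 0 < m).
{ unfold m. destruct (Rle_dec a b); nra. }
assert (H1 : ln (a / m) <= a / m - 1) by (apply ln_le_sub1, Rdiv_lt_0_compat; lra).
assert (H2 : ln (b / m) <= b / m - 1) by (apply ln_le_sub1, Rdiv_lt_0_compat; lra).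
rewrite ln_div in H1, H2 by assumption.
assert (E : l * (a / m) + (1 - l) * (b / m) = 1) by (unfold m; field; fold m; lra).
unfold geomean. rewrite <- (exp_ln m) by assumption. apply exp_le_compat. nra.
Qed.

Lemma geomean_mult l a b c d : 0 < a -> 0 < b -> 0 < c -> 0 < d ->
  geomean l (a * c) (b * d) = geomean l a b * geomean l c d.
Proof. intros. unfold geomean. rewrite <- exp_plus, !ln_mult by assumption. f_equal. ring. Qed.

Lemma geomean_same l a : 0 < a -> geomean l a a = a.
Proof.
intros. unfold geomean. replace (l * ln a + (1 - l) * ln a) with (ln a) by ring. apply exp_ln. assumption.
Qed.

Lemma geomean_le l a b c d : 0 <= l <= 1 -> 0 < a -> 0 < b -> a <= c -> b <= d ->
  geomean l a b <= geomean l c d.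
Proof.
intros Hl Ha Hb Hac Hbd. apply exp_le_compat.
assert (ln a <= ln c) by (apply ln_le_compat; lra).
assert (ln b <= ln d) by (apply ln_le_compat; lra). nra.
Qed.

Lemma geomean_min l a b : 0 <= l <= 1 -> 0 < a -> 0 < b -> Rmin a b <= geomean l a b.
Proof.
intros Hl Ha Hb. assert (0 < Rmin a b) by (apply Rmin_glb_lt; assumption).
rewrite <- (geomean_same l (Rmin a b)) by assumption.
apply geomean_le; auto; [apply Rmin_l | apply Rmin_r].
Qed.

Lemma qconcave_zero B : qconcave B 0 (fun _ => 0).
Proof.
split; [intros; lra|split; [intros x H; exfalso; apply H; reflexivity|]].
intros x y z _. apply Rmin_l.
Qed.

Lemma qint_zero : qint (fun _ => 0) = 0.
Proof.
apply Rle_antisym.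
- assert (H := qint_upper 0 0 _ (qconcave_zero _)). lra.
- apply (qint_nonneg 0 0), qconcave_zero.
Qed.

Lemma qconcave_sup B M f : qconcave B M f -> 0 < qint f ->
  exists m, 0 < m /\ (forall x, f x <= m) /\ (forall t, t < m -> exists x, t < f x).
Proof.
intros U HJ.
destruct (completeness (fun r => exists x, r = f x)) as [m [H1 H2]].
- exists M. intros r [x ->]. apply U.
- exists (f 0), 0. reflexivity.
- assert (Hm : forall x, f x <= m) by (intros x; apply H1; exists x; reflexivity).
  exists m. split; [|split; [assumption|]].
  + destruct (Rlt_dec 0 m) as [|N]; [assumption|]. exfalso.
    rewrite (qint_ext _ (fun _ => 0)), qint_zero in HJ; [lra|].
    intros x. specialize (Hm x). destruct U as [U _]. specialize (U x). lra.
  + intros t Ht. apply Classical_Prop.NNPP. intros N.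
    assert (m <= t); [|lra]. apply H2. intros r [x ->].
    apply Rnot_lt_le. intros Hx. apply N. exists x. assumption.
Qed.

(** The bound on superlevel sets in dimension one adds interval lengths and so needs both sets
    nonempty. If no sample point reaches the level, a point provided by the definition of the
    supremum stands in as a degenerate interval. *)
Lemma level_points f m t c h L : 0 < h -> 0 < m -> 0 < t < 1 ->
  (forall t, t < m -> exists x, t < f x) ->
  exists x y, x <= y /\ t * m <= f x /\ t * m <= f y /\
    h * lsum (pts c h L) (fun s => level (f s / m) t) <= y - x + h.
Proof.
intros Hh Hm Ht Hsup.
assert (K : forall x, t <= f x / m -> t * m <= f x).
{ intros x H. apply Rmult_le_compat_r with (r := m) in H; [|lra].
  unfold Rdiv in H. rewrite Rmult_assoc, Rinv_l, Rmult_1_r in H; lra. }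
destruct (cnt_upper c h L (fun s => f s / m) t Hh) as [E|[x [y [Hxy [Hx [Hy E]]]]]].
- destruct (Hsup (t * m)) as [x Hx]; [nra|].
  exists x, x. rewrite E. repeat split; lra.
- exists x, y. auto.
Qed.

(* One-dimensional Prekopa-Leindler: after normalising both suprema to 1, the level sets satisfy
   |{H >= t}| >= l |{f >= t}| + (1-l) |{g >= t}|, and AM-GM concludes. *)
Lemma qint_PL B M f B' M' g B'' M'' H l :
  qconcave B M f -> qconcave B' M' g -> qconcave B'' M'' H -> 0 <= l <= 1 ->
  (forall x y, 0 < f x -> 0 < g y -> geomean l (f x) (g y) <= H (l * x + (1 - l) * y)) ->
  0 < qint f -> 0 < qint g -> geomean l (qint f) (qint g) <= qint H.
Proof.
intros Uf Ug UH Hl HPL Jf Jg.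
destruct (qconcave_sup _ _ _ Uf Jf) as [m [Hm [Hm1 Hm2]]].
destruct (qconcave_sup _ _ _ Ug Jg) as [m' [Hm' [Hm1' Hm2']]].
set (G := geomean l m m'). assert (HG : 0 < G) by apply geomean_pos.
assert (Main : l * (qint f / m) + (1 - l) * (qint g / m') <= qint H / G).
{ apply (le_of_small _ _ (2 + l * (M / m) + (1 - l) * (M' / m') + M'' / G)). intros h Hh.
  destruct (cover h (Rmax B (Rmax B' B''))) as [L HL]; [lra|].
  assert (R1 := Rmax_l B (Rmax B' B'')). assert (R2 := Rmax_r B (Rmax B' B'')).
  assert (R3 := Rmax_l B' B''). assert (R4 := Rmax_r B' B'').
  set (p := pts 0 h L).
  (* Capping [H s / G] at 1 puts all three families in [[0, 1]], as [layer_cake] requires, and only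
     lowers the integral of [H]. *)
  set (lst := map (fun s => (l * h, f s / m)) p ++
              (map (fun s => ((1 - l) * h, g s / m')) p ++
               map (fun s => (- h, Rmin (H s / G) 1)) p)).
  assert (LC : lsum lst (fun q => fst q * snd q) <= (2 * h) * 1).
  { apply layer_cake; [lra | |].
    - intros q Hq. unfold lst in Hq.
      apply in_app_or in Hq. destruct Hq as [Hq|Hq]; [|apply in_app_or in Hq; destruct Hq as [Hq|Hq]];
      apply in_map_iff in Hq; destruct Hq as [s [<- _]]; simpl.
      + destruct Uf as [U _]. specialize (U s). specialize (Hm1 s).
        split; [apply Rle_mult_inv_pos; lra|].
        apply Rmult_le_reg_r with m; [lra|]. replace (f s / m * m) with (f s) by (field; lra). lra.
      + destruct Ug as [U _]. specialize (U s). specialize (Hm1' s).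
        split; [apply Rle_mult_inv_pos; lra|].
        apply Rmult_le_reg_r with m'; [lra|]. replace (g s / m' * m') with (g s) by (field; lra). lra.
      + destruct UH as [U _]. specialize (U s).
        split; [|apply Rmin_r]. apply Rmin_glb; [apply Rle_mult_inv_pos; lra | lra].
    - intros t Ht. unfold lst. rewrite !lsum_app, !lsum_map. simpl. rewrite !lsum_scal.
      destruct (level_points f m t 0 h L ltac:(lra) Hm Ht Hm2) as [x1 [x2 [Hx [X1 [X2 X3]]]]].
      destruct (level_points g m' t 0 h L ltac:(lra) Hm' Ht Hm2') as [y1 [y2 [Hy [Y1 [Y2 Y3]]]]].
      fold p in X3, Y3.
      assert (LH : forall x y, t * m <= f x -> t * m' <= g y -> t * G <= H (l * x + (1 - l) * y)).
      { intros x y Ax Ay. assert (0 < t * m) by nra. assert (0 < t * m') by nra.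
        eapply Rle_trans; [|apply HPL; lra].
        rewrite <- (geomean_same l t) at 1 by lra. unfold G. rewrite <- geomean_mult by lra.
        apply geomean_le; auto; lra. }
      assert (Z1 := LH _ _ X1 Y1). assert (Z2 := LH _ _ X2 Y2).
      assert (HtG : 0 < t * G) by nra.
      assert (B1 := qconcave_supp _ _ _ _ _ UH HtG Z1). assert (B2 := qconcave_supp _ _ _ _ _ UH HtG Z2).
      apply Rabs_le_inv in B1. apply Rabs_le_inv in B2.
      (* Convex combinations of the left and of the right endpoints give an interval in the level
         set of [H]. Its length is the combination of the lengths; the rounding errors [l * h],
         [(1 - l) * h] and [h] add up to [2 * h]. *)
      set (z1 := l * x1 + (1 - l) * y1) in *. set (z2 := l * x2 + (1 - l) * y2) in *.
      assert (Hz : z1 <= z2) by (unfold z1, z2; nra).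
      assert (C : z2 - z1 - h <= h * lsum p (fun s => level (Rmin (H s / G) 1) t)).
      { apply cnt_lower; try lra. intros s Hs. apply Rmin_glb; [|lra].
        assert (E := qconcave_level _ _ _ _ _ _ UH Z1 Z2 s Hs).
        apply Rmult_le_reg_r with G; [lra|]. replace (H s / G * G) with (H s) by (field; lra). lra. }
      unfold z1, z2 in C.
      assert (l * (h * lsum p (fun s => level (f s / m) t)) <= l * (x2 - x1 + h))
        by (apply Rmult_le_compat_l; lra).
      assert ((1 - l) * (h * lsum p (fun s => level (g s / m') t)) <= (1 - l) * (y2 - y1 + h))
        by (apply Rmult_le_compat_l; lra).
      lra. }
  unfold lst in LC. rewrite !lsum_app, !lsum_map in LC. simpl in LC. rewrite !lsum_scal in LC.
  assert (E1 : lsum p (fun s => f s / m) = lsum p f / m).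
  { rewrite (lsum_ext _ _ _ (fun s => / m * f s)) by (intros; unfold Rdiv; ring).
    rewrite lsum_scal. unfold Rdiv; ring. }
  assert (E2 : lsum p (fun s => g s / m') = lsum p g / m').
  { rewrite (lsum_ext _ _ _ (fun s => / m' * g s)) by (intros; unfold Rdiv; ring).
    rewrite lsum_scal. unfold Rdiv; ring. }
  assert (E3 : lsum p (fun s => Rmin (H s / G) 1) <= lsum p H / G).
  { replace (lsum p H / G) with (lsum p (fun s => / G * H s))
      by (rewrite lsum_scal; unfold Rdiv; ring).
    apply lsum_le. intros s _. rewrite Rmult_comm. apply Rmin_l. }
  assert (A1 := qint_approx0 _ _ _ h L Uf ltac:(lra) ltac:(lra)).
  assert (A2 := qint_approx0 _ _ _ h L Ug ltac:(lra) ltac:(lra)).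
  assert (A3 := qint_approx0 _ _ _ h L UH ltac:(lra) ltac:(lra)).
  apply Rabs_le_inv in A1. apply Rabs_le_inv in A2. apply Rabs_le_inv in A3.
  unfold sum1 in A1, A2, A3. fold p in A1, A2, A3. rewrite E1, E2 in LC.
  assert (I1 : 0 < / m) by (apply Rinv_0_lt_compat; lra).
  assert (I2 : 0 < / m') by (apply Rinv_0_lt_compat; lra).
  assert (I3 : 0 < / G) by (apply Rinv_0_lt_compat; lra).
  assert (F1 : qint f / m <= h * (lsum p f / m) + h * (M / m)) by (unfold Rdiv; nra).
  assert (F2 : qint g / m' <= h * (lsum p g / m') + h * (M' / m')) by (unfold Rdiv; nra).
  assert (F3 : h * (lsum p H / G) <= qint H / G + h * (M'' / G)) by (unfold Rdiv; nra).
  assert (h * lsum p (fun s => Rmin (H s / G) 1) <= h * (lsum p H / G))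
    by (apply Rmult_le_compat_l; lra).
  assert (l * (qint f / m) <= l * (h * (lsum p f / m) + h * (M / m)))
    by (apply Rmult_le_compat_l; lra).
  assert ((1 - l) * (qint g / m') <= (1 - l) * (h * (lsum p g / m') + h * (M' / m')))
    by (apply Rmult_le_compat_l; lra).
  lra. }
assert (P1 : 0 < qint f / m) by (apply Rdiv_lt_0_compat; lra).
assert (P2 : 0 < qint g / m') by (apply Rdiv_lt_0_compat; lra).
assert (AG := geomean_amgm l _ _ Hl P1 P2).
replace (qint f) with (m * (qint f / m)) by (field; lra).
replace (qint g) with (m' * (qint g / m')) by (field; lra).
rewrite geomean_mult by assumption. fold G.
replace (qint H) with (G * (qint H / G)) by (field; lra).
apply Rmult_le_compat_l; lra.
Qed.

(** The last coordinate is the outermost variable, as in [gridsum] and [grid], so volume and lattice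
    sums are compared by one recursion. *)
Fixpoint vol (k : nat) (A : Vec -> Prop) : R :=
  match k with
  | O => ind A (fun _ => 0)
  | S k' => qint (fun s => vol k' (fun x => A (upd x k' s)))
  end.

Definition convex_in_box (k B : nat) (A : Vec -> Prop) : Prop :=
  convex_set k A /\ forall x, A x -> forall i, (i < k)%nat -> Rabs (x i) <= INR B.

Lemma upd_same x k s : upd x k s k = s.
Proof. unfold upd. rewrite Nat.eqb_refl. reflexivity. Qed.

Lemma upd_other x k s i : i <> k -> upd x k s i = x i.
Proof. intros H. unfold upd. destruct (Nat.eqb_spec i k); congruence. Qed.

Lemma upd_supp x k s : supp k x -> supp (S k) (upd x k s).
Proof. intros H j Hj. rewrite upd_other by lia. apply H. lia. Qed.

Lemma upd_comb t x s y s' k :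
  upd (fun i => t * x i + (1 - t) * y i) k (t * s + (1 - t) * s') =
  (fun i => t * upd x k s i + (1 - t) * upd y k s' i).
Proof. extensionality i. unfold upd. destruct (Nat.eqb i k); reflexivity. Qed.

Lemma convex_in_box_section k B A s : convex_in_box (S k) B A -> convex_in_box k B (fun x => A (upd x k s)).
Proof.
intros [C Bd]. split.
- intros x y t Hx Hy Ht. specialize (C _ _ t Hx Hy Ht). rewrite <- upd_comb in C.
  replace (t * s + (1 - t) * s) with s in C by ring. exact C.
- intros x Hx i Hi. specialize (Bd _ Hx i ltac:(lia)). rewrite upd_other in Bd by lia. exact Bd.
Qed.

Lemma vol_ext k A A' : (forall x, supp k x -> (A x <-> A' x)) -> vol k A = vol k A'.
Proof.
revert A A'. induction k as [|k IH]; intros A A' H; simpl.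
- assert (E := H (fun _ => 0) (fun j _ => eq_refl)).
  unfold ind. repeat destruct excluded_middle_informative; tauto.
- apply qint_ext. intros s. apply IH. intros x Hx. apply H, upd_supp, Hx.
Qed.

Lemma vol_empty k A : (forall x, ~ A x) -> vol k A = 0.
Proof.
revert A. induction k as [|k IH]; intros A H; simpl.
- unfold ind. destruct excluded_middle_informative as [E|]; [exfalso; exact (H _ E)|reflexivity].
- rewrite (qint_ext _ (fun _ => 0)); [apply qint_zero|]. intros s. apply IH. auto.
Qed.

Lemma ind_bound A x : 0 <= ind A x <= 1.
Proof. unfold ind. destruct excluded_middle_informative; lra. Qed.

(** The three claims need each other: the Prekopa-Leindler step in dimension [k + 1] integrates
    section volumes, which must be known to be quasi-concave, and this quasi-concavity is the
    inequality in dimension [k] combined with geometric mean >= minimum. *)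
Lemma vol_bound_PL k :
  (forall B A, convex_in_box k B A -> 0 <= vol k A <= (2 * INR B + 2) ^ k) /\
  (forall B A A1 A2 l, convex_in_box k B A -> convex_in_box k B A1 ->
    convex_in_box k B A2 -> 0 <= l <= 1 ->
    (forall x y, A x -> A1 y -> A2 (fun i => l * x i + (1 - l) * y i)) ->
    0 < vol k A -> 0 < vol k A1 -> geomean l (vol k A) (vol k A1) <= vol k A2) /\
  (forall B A, convex_in_box (S k) B A ->
    qconcave (INR B) ((2 * INR B + 2) ^ k) (fun s => vol k (fun x => A (upd x k s)))).
Proof.
induction k as [|k [IH1 [IH2 IH3]]].
1: assert (G1 : forall B A, convex_in_box 0 B A -> 0 <= vol 0 A <= (2 * INR B + 2) ^ 0) by
     (intros; simpl; apply ind_bound).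
1: assert (G2 : forall B A A1 A2 l, convex_in_box 0 B A -> convex_in_box 0 B A1 -> convex_in_box 0 B A2 ->
    0 <= l <= 1 ->
    (forall x y, A x -> A1 y -> A2 (fun i => l * x i + (1 - l) * y i)) ->
    0 < vol 0 A -> 0 < vol 0 A1 -> geomean l (vol 0 A) (vol 0 A1) <= vol 0 A2).
{ intros B A A1 A2 l _ _ _ _ H. simpl. unfold ind.
  destruct excluded_middle_informative as [a|]; [|lra].
  destruct excluded_middle_informative as [b|]; [|lra].
  intros _ _. specialize (H _ _ a b).
  destruct excluded_middle_informative as [|n].
  - rewrite geomean_same; lra.
  - exfalso; apply n.
    replace (fun _ : nat => 0) with (fun i : nat => l * 0 + (1 - l) * 0); [exact H|].
    extensionality i. ring. }
2: assert (G1 : forall B A, convex_in_box (S k) B A -> 0 <= vol (S k) A <= (2 * INR B + 2) ^ (S k)).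
2:{ intros B A H. specialize (IH3 B A H). simpl. split.
    - apply (qint_nonneg _ _ _ IH3).
    - apply (qint_upper _ _ _ IH3). }
2: assert (G2 : forall B A A1 A2 l, convex_in_box (S k) B A -> convex_in_box (S k) B A1 ->
    convex_in_box (S k) B A2 -> 0 <= l <= 1 ->
    (forall x y, A x -> A1 y -> A2 (fun i => l * x i + (1 - l) * y i)) ->
    0 < vol (S k) A -> 0 < vol (S k) A1 -> geomean l (vol (S k) A) (vol (S k) A1) <= vol (S k) A2).
2:{ intros B A A1 A2 l H H1 H2 Hl HC. simpl. apply (qint_PL _ _ _ _ _ _ _ _ _ _ (IH3 _ _ H)
      (IH3 _ _ H1) (IH3 _ _ H2) Hl).
    intros s s' Hs Hs'. apply (IH2 B); auto using convex_in_box_section.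
    intros x y Hx Hy. rewrite upd_comb. apply HC; assumption. }
all: split; [exact G1|split; [exact G2|]].
all: intros B A H; split; [intros s; apply G1; apply convex_in_box_section, H|split].
1,3: intros s Hs; apply Rnot_lt_le; intros N; apply Hs; apply vol_empty; intros x Hx;
     destruct H as [_ H]; specialize (H _ Hx _ (Nat.lt_succ_diag_r _));
     rewrite upd_same in H; lra.
all: intros x y z Hxyz.
all: match goal with |- Rmin ?a ?b <= ?c => assert (Pa : 0 <= a) by (apply (G1 B), convex_in_box_section, H);
  assert (Pb : 0 <= b) by (apply (G1 B), convex_in_box_section, H);
  assert (Pc : 0 <= c) by (apply (G1 B), convex_in_box_section, H);
  destruct (Req_dec a 0) as [Ea|Ea]; [eapply Rle_trans; [apply Rmin_l|lra]|];
  destruct (Req_dec b 0) as [Eb|Eb]; [eapply Rle_trans; [apply Rmin_r|lra]|] end.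
(* [y] is written as a convex combination of [x] and [z], whose sections have positive volume by
   now; if [x = z] any weight will do. *)
all: assert (Hl : exists l, 0 <= l <= 1 /\ y = l * x + (1 - l) * z) by
  (destruct (Req_dec x z) as [E|E];
   [exists 0; split; lra|
    exists ((z - y) / (z - x)); split; [|field; lra]; split;
    [apply Rle_mult_inv_pos; lra|
     apply Rmult_le_reg_r with (z - x); [lra|];
     replace ((z - y) / (z - x) * (z - x)) with (z - y) by (field; lra); lra]]).
all: destruct Hl as [l [Hl Hy]].
all: eapply Rle_trans; [apply (geomean_min l); lra|]; apply (G2 B); try lra; auto using convex_in_box_section.
all: intros u w Hu Hw; rewrite Hy, upd_comb; apply H; assumption.
Qed.

Lemma vol_bound k B A : convex_in_box k B A -> 0 <= vol k A <= (2 * INR B + 2) ^ k.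
Proof. apply vol_bound_PL. Qed.

Lemma vol_PL k B A A1 A2 l : convex_in_box k B A -> convex_in_box k B A1 ->
    convex_in_box k B A2 -> 0 <= l <= 1 ->
    (forall x y, A x -> A1 y -> A2 (fun i => l * x i + (1 - l) * y i)) ->
    0 < vol k A -> 0 < vol k A1 -> geomean l (vol k A) (vol k A1) <= vol k A2.
Proof. apply vol_bound_PL. Qed.

Lemma vol_section_qconcave k B A : convex_in_box (S k) B A ->
    qconcave (INR B) ((2 * INR B + 2) ^ k) (fun s => vol k (fun x => A (upd x k s))).
Proof. apply vol_bound_PL. Qed.

(** The first term is the error of the outer integral, whose integrand is at most [(2B+2)^k']; the
    second is the error of the sections, accumulated over a sampled length of at most [2B + 1]. *)
Fixpoint vol_error (k B : nat) : R :=
  match k with O => 0 | S k' => (2 * INR B + 2) ^ k' + (2 * INR B + 1) * vol_error k' B end.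

Lemma vol_error_nonneg k B : 0 <= vol_error k B.
Proof.
assert (H := pos_INR B).
induction k as [|k IH]; simpl; [lra|]. assert (0 <= (2 * INR B + 2) ^ k) by (apply pow_le; lra). nra.
Qed.

(* The error is uniform over all convex sets in the box, whatever the dimension of their span. *)
Lemma vol_approx k B A h L : convex_in_box k B A -> 0 < h <= 1 -> h * INR L = INR B ->
  Rabs (h ^ k * lsum (grid k L h) (ind A) - vol k A) <= vol_error k B * h.
Proof.
intros HA Hh HL. revert A HA. induction k as [|k IH]; intros A HA.
- simpl. rewrite Rplus_0_r, Rmult_1_l, Rminus_diag, Rabs_R0. lra.
- rewrite lsum_grid_S. simpl vol. assert (U := vol_section_qconcave _ _ _ HA).
  set (g := fun s => vol k (fun x => A (upd x k s))) in *.
  assert (A1 := qint_approx0 _ _ _ h L U ltac:(lra) ltac:(lra)). unfold sum1 in A1.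
  set (c := fun s => lsum (grid k L h) (fun x => ind A (upd x k s))).
  assert (E : h ^ S k * lsum (pts 0 h L) c - qint g
    = h * lsum (pts 0 h L) (fun s => h ^ k * c s - g s) + (h * lsum (pts 0 h L) g - qint g)).
  { rewrite lsum_minus, lsum_scal. simpl. ring. }
  fold c. rewrite E. eapply Rle_trans; [apply Rabs_triang|].
  assert (D : Rabs (h * lsum (pts 0 h L) (fun s => h ^ k * c s - g s))
    <= (2 * INR B + 1) * vol_error k B * h).
  { rewrite Rabs_mult, (Rabs_pos_eq h) by lra.
    eapply Rle_trans; [apply Rmult_le_compat_l; [lra|apply lsum_abs]|].
    eapply Rle_trans; [apply Rmult_le_compat_l; [lra|]; apply (lsum_le _ _ _ (fun _ => vol_error k B * h))|].
    - intros s _. apply (IH _ (convex_in_box_section _ _ _ s HA)).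
    - rewrite lsum_const, length_pts, plus_INR, mult_INR. change (INR 2) with 2. change (INR 1) with 1.
      assert (P := vol_error_nonneg k B). assert (Q := pos_INR L).
      transitivity ((2 * INR B + h) * (vol_error k B * h)); [right; rewrite <- HL; ring|].
      replace ((2 * INR B + 1) * vol_error k B * h) with ((2 * INR B + 1) * (vol_error k B * h)) by ring.
      apply Rmult_le_compat_r; [nra|lra]. }
  simpl vol_error. lra.
Qed.

Lemma vol_translate k B A a : convex_in_box k B A -> supp k a ->
  vol k (fun x => A (fun i => a i + x i)) = vol k A.
Proof.
revert A a. induction k as [|k IH]; intros A a HA Ha; simpl.
- transitivity (ind A (fun i => a i + 0)); [reflexivity|]. f_equal.
  extensionality i. rewrite Ha by lia. ring.
- assert (U := vol_section_qconcave _ _ _ HA).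
  rewrite (qint_ext _ (fun s => vol k (fun x => A (upd x k (a k + 1 * s))))).
  + rewrite (qint_affine _ _ _ (a k) 1 U) by lra. lra.
  + intros s. rewrite <- (IH (fun x => A (upd x k (a k + 1 * s))) (upd a k 0)).
    * apply vol_ext. intros x _. cbv beta. rewrite Rmult_1_l.
      replace (upd (fun i => upd a k 0 i + x i) k (a k + s)) with (fun i => a i + upd x k s i);
        [tauto|].
      extensionality i. unfold upd. destruct (Nat.eqb_spec i k); subst; reflexivity.
    * apply convex_in_box_section. assumption.
    * intros j Hj. unfold upd. destruct (Nat.eqb_spec j k); [reflexivity|apply Ha; lia].
Qed.

Lemma vol_scale k B A c : convex_in_box k B A -> 0 < c ->
  vol k (fun x => A (fun i => c * x i)) = vol k A / c ^ k.
Proof.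
intros HA Hc. revert A HA. induction k as [|k IH]; intros A HA; simpl.
- transitivity (ind A (fun _ => c * 0)); [reflexivity|].
  unfold Rdiv. rewrite Rinv_1, Rmult_1_r. f_equal. extensionality i. ring.
- assert (U := vol_section_qconcave _ _ _ HA).
  assert (Hck : 0 < c ^ k) by (apply pow_lt; assumption).
  rewrite (qint_ext _ (fun s => / c ^ k * vol k (fun x => A (upd x k (0 + c * s))))).
  + rewrite (qint_scal _ _ _ _ (qconcave_affine _ _ _ 0 c U Hc));
      [|left; apply Rinv_0_lt_compat; assumption].
    rewrite (qint_affine _ _ _ 0 c U) by assumption. field. split; lra.
  + intros s. transitivity (vol k (fun x => A (upd x k (0 + c * s))) / c ^ k); [|unfold Rdiv; ring].
    rewrite <- IH by (apply convex_in_box_section; assumption).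
    apply vol_ext. intros x _. cbv beta.
    replace (upd (fun i => c * x i) k (0 + c * s)) with (fun i => c * upd x k s i); [tauto|].
    extensionality i. unfold upd. destruct (Nat.eqb_spec i k); [ring|reflexivity].
Qed.

Lemma vol_lower k B A a r : convex_in_box k B A -> 0 <= r ->
  (forall x, supp k x -> (forall i, (i < k)%nat -> Rabs (x i - a i) <= r) -> A x) ->
  (2 * r) ^ k <= vol k A.
Proof.
intros HA Hr. revert A HA. induction k as [|k IH]; intros A HA H; simpl.
- unfold ind. destruct excluded_middle_informative as [|n]; [lra|].
  exfalso. apply n, H; [intros j _; reflexivity | intros; lia].
- assert (U := vol_section_qconcave _ _ _ HA).
  assert (P : 0 <= (2 * r) ^ k) by (apply pow_le; lra).
  eapply Rle_trans; [|apply (qint_lower _ _ _ (a k - r) (a k + r) ((2 * r) ^ k) U); [lra|assumption|]].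
  + right. ring.
  + intros s Hs. apply IH; [apply convex_in_box_section; assumption|].
    intros x Hx Hxi. apply H; [apply upd_supp; assumption|].
    intros i Hi. unfold upd. destruct (Nat.eqb_spec i k) as [->|].
    * apply Rabs_le. lra.
    * apply Hxi. lia.
Qed.

(** * Orthonormal families *)

Lemma rsum_ext m f g : (forall i, (i < m)%nat -> f i = g i) -> rsum m f = rsum m g.
Proof.
intros H. rewrite !rsum_lsum. apply lsum_ext. intros i Hi. apply in_seq in Hi. apply H. lia.
Qed.

Lemma rsum_le m f g : (forall i, (i < m)%nat -> f i <= g i) -> rsum m f <= rsum m g.
Proof.
intros H. rewrite !rsum_lsum. apply lsum_le. intros i Hi. apply in_seq in Hi. apply H. lia.
Qed.

Lemma rsum_plus m f g : rsum m (fun i => f i + g i) = rsum m f + rsum m g.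
Proof. rewrite !rsum_lsum. apply lsum_plus. Qed.

Lemma rsum_minus m f g : rsum m (fun i => f i - g i) = rsum m f - rsum m g.
Proof. rewrite !rsum_lsum. apply lsum_minus. Qed.

Lemma rsum_scal m c f : rsum m (fun i => c * f i) = c * rsum m f.
Proof. rewrite !rsum_lsum. apply lsum_scal. Qed.

Lemma rsum_const m c : rsum m (fun _ => c) = INR m * c.
Proof. rewrite rsum_lsum, lsum_const, length_seq. reflexivity. Qed.

Lemma rsum_zero m f : (forall i, (i < m)%nat -> f i = 0) -> rsum m f = 0.
Proof. intros H. rewrite (rsum_ext _ _ (fun _ => 0)), rsum_const by assumption. ring. Qed.

Lemma rsum_nonneg m f : (forall i, (i < m)%nat -> 0 <= f i) -> 0 <= rsum m f.
Proof. intros H. rewrite <- (rsum_zero m (fun _ => 0)) by auto. apply rsum_le; assumption. Qed.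

Lemma rsum_swap m n f :
  rsum m (fun i => rsum n (fun j => f i j)) = rsum n (fun j => rsum m (fun i => f i j)).
Proof.
rewrite !rsum_lsum.
rewrite (lsum_ext _ _ _ (fun i => lsum (seq 0 n) (fun j => f i j)))
  by (intros; apply rsum_lsum).
rewrite lsum_swap. apply lsum_ext. intros. symmetry. apply rsum_lsum.
Qed.

Lemma rsum_term m f i : (forall i, (i < m)%nat -> 0 <= f i) -> (i < m)%nat -> f i <= rsum m f.
Proof.
intros H Hi. induction m as [|m IH]; [lia|]. simpl.
assert (0 <= f m) by (apply H; lia).
destruct (Nat.eq_dec i m) as [->|].
- assert (0 <= rsum m f) by (apply rsum_nonneg; intros; apply H; lia). lra.
- assert (f i <= rsum m f) by (apply IH; [intros; apply H|]; lia). lra.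
Qed.

Lemma rsum_delta m f j : (j < m)%nat -> rsum m (fun i => f i * (if Nat.eqb i j then 1 else 0)) = f j.
Proof.
intros Hj. induction m as [|m IH]; [lia|]. simpl.
destruct (Nat.eqb_spec m j) as [->|].
- rewrite rsum_zero; [ring|]. intros i Hi. destruct (Nat.eqb_spec i j); [lia|ring].
- rewrite IH by lia. ring.
Qed.

Lemma dot_comm n x y : dot n x y = dot n y x.
Proof. apply rsum_ext. intros. ring. Qed.

Lemma dot_lincomb_l n k b t y :
  dot n (lincomb k b t) y = rsum k (fun i => t i * dot n (b i) y).
Proof.
unfold dot, lincomb.
rewrite (rsum_ext n _ (fun j => rsum k (fun i => t i * (b i j * y j)))).
- rewrite rsum_swap. apply rsum_ext. intros i _. apply rsum_scal.
- intros j _. rewrite Rmult_comm, <- rsum_scal. apply rsum_ext. intros. ring.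
Qed.

Lemma dot_lincomb_r n k b t y :
  dot n y (lincomb k b t) = rsum k (fun i => t i * dot n y (b i)).
Proof.
rewrite dot_comm, dot_lincomb_l. apply rsum_ext. intros. rewrite (dot_comm n y). reflexivity.
Qed.

Lemma dot_lincomb_basis n k b t j : orthonormal n k b -> (j < k)%nat ->
  dot n (lincomb k b t) (b j) = t j.
Proof.
intros [_ O] Hj. rewrite dot_lincomb_l, <- (rsum_delta k t j) by assumption.
apply rsum_ext. intros i Hi. rewrite O by assumption. reflexivity.
Qed.

Lemma dot_lincomb n k b s t : orthonormal n k b ->
  dot n (lincomb k b s) (lincomb k b t) = dot k s t.
Proof.
intros O. rewrite dot_lincomb_l. apply rsum_ext. intros i Hi.
rewrite dot_comm, dot_lincomb_basis by assumption. reflexivity.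
Qed.

Lemma lincomb_supp n k b t : orthonormal n k b -> supp n (lincomb k b t).
Proof.
intros [O _] j Hj. apply rsum_zero. intros i Hi. rewrite (O i Hi j Hj). ring.
Qed.

Lemma lincomb_lin k b a s c t :
  lincomb k b (fun i => a * s i + c * t i) = (fun j => a * lincomb k b s j + c * lincomb k b t j).
Proof.
extensionality j. unfold lincomb. rewrite <- !rsum_scal, <- rsum_plus. apply rsum_ext.
intros. ring.
Qed.

Lemma lincomb_eq k b b' s t :
  (forall i, (i < k)%nat -> s i = t i) -> (forall i, (i < k)%nat -> b i = b' i) ->
  lincomb k b s = lincomb k b' t.
Proof.
intros H H'. extensionality j. apply rsum_ext. intros i Hi.
rewrite (H i Hi), (H' i Hi). reflexivity.
Qed.

Definition nsq (k : nat) (x : Vec) : R := dot k x x.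

Lemma nsq_nonneg k x : 0 <= nsq k x.
Proof. apply rsum_nonneg. intros. nra. Qed.

Lemma nsq_coord k x i : (i < k)%nat -> x i * x i <= nsq k x.
Proof. intros Hi. apply (rsum_term k (fun i => x i * x i) i); [intros; nra|assumption]. Qed.

Lemma nsq_coord_abs k x i r : (i < k)%nat -> 0 <= r -> nsq k x <= r * r -> Rabs (x i) <= r.
Proof.
intros Hi Hr H. assert (E := nsq_coord k x i Hi). apply Rabs_le. split; nra.
Qed.

Lemma nsq_ext k x y : (forall i, (i < k)%nat -> x i = y i) -> nsq k x = nsq k y.
Proof. intros H. apply rsum_ext. intros i Hi. rewrite (H i Hi). reflexivity. Qed.

Lemma nsq_scal k c x : nsq k (fun i => c * x i) = c * c * nsq k x.
Proof. unfold nsq, dot. rewrite <- rsum_scal. apply rsum_ext. intros. ring. Qed.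

Lemma nsq_sub_sym k x y : nsq k (fun i => x i - y i) = nsq k (fun i => y i - x i).
Proof. apply rsum_ext. intros. ring. Qed.

Lemma nsq_convex k t x y : 0 <= t <= 1 ->
  nsq k (fun i => t * x i + (1 - t) * y i) <= t * nsq k x + (1 - t) * nsq k y.
Proof.
intros Ht. unfold nsq, dot. rewrite <- !rsum_scal, <- rsum_plus. apply rsum_le. intros i _.
assert (0 <= t * (1 - t)) by nra.
assert (0 <= t * (1 - t) * ((x i - y i) * (x i - y i))) by 
  (apply Rmult_le_pos; [assumption | apply Rle_0_sqr]). nra.
Qed.

Lemma bessel_residual n k b x : orthonormal n k b ->
  nsq n (fun j => x j - lincomb k b (fun i => dot n x (b i)) j)
  = nsq n x - rsum k (fun i => dot n x (b i) * dot n x (b i)).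
Proof.
intros O. set (t := fun i => dot n x (b i)).
assert (E : nsq n (fun j => x j - lincomb k b t j)
  = nsq n x - 2 * dot n x (lincomb k b t) + nsq n (lincomb k b t)).
{ unfold nsq, dot. rewrite <- rsum_scal, <- rsum_minus, <- rsum_plus.
  apply rsum_ext. intros. ring. }
rewrite E. unfold nsq at 2. rewrite dot_lincomb, dot_lincomb_r by assumption.
set (S := rsum k (fun i => dot n x (b i) * dot n x (b i))).
change (dot k t t) with S. change (rsum k (fun i => t i * dot n x (b i))) with S. lra.
Qed.

(* The residuals of the coordinate vectors are nonnegative and, by comparing traces, sum to zero. *)
Lemma orthonormal_dual n b j l : orthonormal n n b -> (j < n)%nat -> (l < n)%nat ->
  rsum n (fun i => b i j * b i l) = if Nat.eqb j l then 1 else 0.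
Proof.
intros O Hj Hl.
set (e := fun (j i : nat) => if Nat.eqb i j then 1 else 0).
assert (De : forall x j, (j < n)%nat -> dot n (e j) x = x j).
{ intros x q Hq. rewrite dot_comm. apply rsum_delta. assumption. }
set (res := fun j => nsq n (fun q => e j q - lincomb n b (fun i => dot n (e j) (b i)) q)).
assert (Hres : forall j, (j < n)%nat -> res j = 1 - rsum n (fun i => b i j * b i j)).
{ intros q Hq. unfold res. rewrite bessel_residual by assumption. f_equal.
  - unfold nsq. rewrite De by assumption. unfold e. rewrite Nat.eqb_refl. reflexivity.
  - apply rsum_ext. intros i _. rewrite De by assumption. reflexivity. }
assert (Hsum : rsum n res = 0).
{ rewrite (rsum_ext _ _ _ Hres), rsum_minus, rsum_swap, rsum_const.
  rewrite (rsum_ext n _ (fun _ => 1)), rsum_const; [ring|].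
  intros i Hi. destruct O as [_ O]. specialize (O i i Hi Hi). rewrite Nat.eqb_refl in O. exact O. }
assert (Hz : res j = 0).
{ apply Rle_antisym; [|apply nsq_nonneg]. rewrite <- Hsum.
  apply rsum_term; [intros; apply nsq_nonneg|assumption]. }
assert (H := nsq_coord n (fun q => e j q - lincomb n b (fun i => dot n (e j) (b i)) q) l Hl).
cbv beta in H. fold (res j) in H. rewrite Hz in H.
set (d := e j l - _) in H. assert (d = 0) by nra. unfold d, lincomb in H0.
rewrite (rsum_ext n _ (fun i => dot n (e j) (b i) * b i l)).
- unfold e in H0 at 1. rewrite Nat.eqb_sym. lra.
- intros i _. rewrite De by assumption. reflexivity.
Qed.

Lemma orthonormal_complete n b x : orthonormal n n b -> supp n x ->
  lincomb n b (fun i => dot n x (b i)) = x.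
Proof.
intros O Hx. extensionality l. destruct (Nat.lt_ge_cases l n) as [Hl|Hl].
- unfold lincomb, dot.
  rewrite (rsum_ext n _ (fun i => rsum n (fun j => x j * (b i j * b i l)))).
  + rewrite rsum_swap. rewrite <- (rsum_delta n x l) by assumption.
    apply rsum_ext. intros j Hj. rewrite rsum_scal, (orthonormal_dual n b j l) by assumption.
    reflexivity.
  + intros i _. rewrite Rmult_comm, <- rsum_scal. apply rsum_ext. intros. ring.
- rewrite (lincomb_supp n n b _ O l Hl). symmetry. apply Hx. assumption.
Qed.

(** The new vector takes index [k], so its coefficient becomes the outermost variable of [vol] and
    [grid]. *)
Definition snoc (k : nat) (b : nat -> Vec) (u : Vec) : nat -> Vec :=
  fun i => if Nat.eqb i k then u else b i.

Lemma orthonormal_snoc n k b u : orthonormal n k b -> unit_vec n u ->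
  (forall i, (i < k)%nat -> dot n u (b i) = 0) -> orthonormal n (S k) (snoc k b u).
Proof.
intros [O1 O2] [U1 U2] H. unfold snoc. split.
- intros i Hi. destruct (Nat.eqb_spec i k); [assumption|apply O1; lia].
- intros i j Hi Hj.
  destruct (Nat.eqb_spec i k) as [->|Hik]; destruct (Nat.eqb_spec j k) as [->|Hjk].
  + rewrite Nat.eqb_refl. assumption.
  + rewrite H by lia. destruct (Nat.eqb_spec k j); [lia|reflexivity].
  + rewrite dot_comm, H by lia. destruct (Nat.eqb_spec i k); [lia|reflexivity].
  + apply O2; lia.
Qed.

Lemma lincomb_snoc_S k b u t j : lincomb (S k) (snoc k b u) t j = lincomb k b t j + t k * u j.
Proof.
unfold lincomb. simpl. unfold snoc at 2. rewrite Nat.eqb_refl. f_equal.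
apply rsum_ext. intros i Hi. unfold snoc. destruct (Nat.eqb_spec i k); [lia|reflexivity].
Qed.

(** Adjoining [u] gives a full orthonormal basis, in which the coefficient of [x] along [u] is 0. *)
Lemma complement_complete n k b u x : S k = n -> orthonormal n k b -> unit_vec n u ->
  (forall i, (i < k)%nat -> dot n u (b i) = 0) -> supp n x -> dot n u x = 0 ->
  lincomb k b (fun i => dot n x (b i)) = x.
Proof.
intros Hk O U H Hx Hux. assert (O' := orthonormal_snoc n k b u O U H). rewrite Hk in O'.
assert (C := orthonormal_complete n _ x O' Hx). 
transitivity (lincomb n (snoc k b u) (fun i => dot n x (snoc k b u i))); [|exact C].
rewrite <- Hk.
extensionality j. rewrite lincomb_snoc_S.
assert (E : dot (S k) x (snoc k b u k) = 0).
{ unfold snoc. rewrite Nat.eqb_refl, Hk, dot_comm. assumption. }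
rewrite E, Rmult_0_l, Rplus_0_r. apply rsum_ext. intros i Hi. unfold snoc.
destruct (Nat.eqb_spec i k); [lia|reflexivity].
Qed.

(** * Rotation of the grid *)

Definition ball (k : nat) (a : Vec) (r : R) : Vec -> Prop :=
  fun x => nsq k (fun i => x i - a i) < r * r.

Lemma ball_convex k a r : convex_set k (ball k a r).
Proof.
intros x y t Hx Hy Ht. unfold ball in *.
rewrite (nsq_ext k _ (fun i => t * (x i - a i) + (1 - t) * (y i - a i))) by (intros; ring).
eapply Rle_lt_trans; [apply nsq_convex; assumption|].
destruct (Req_dec t 0) as [->|]; nra.
Qed.

Lemma ball_convex_in_box k B a r : 0 <= r -> (forall i, (i < k)%nat -> Rabs (a i) + r <= INR B) ->
  convex_in_box k B (ball k a r).
Proof.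
intros Hr Ha. split; [apply ball_convex|].
intros x Hx i Hi. unfold ball in Hx.
assert (H := nsq_coord_abs k _ i r Hi Hr (Rlt_le _ _ Hx)). cbv beta in H.
specialize (Ha i Hi).
replace (x i) with ((x i - a i) + a i) by ring.
eapply Rle_trans; [apply Rabs_triang|]. lra.
Qed.

Lemma ball_vol k B a r : 0 <= r -> r <= INR B -> supp k a ->
  vol k (ball k a r) = vol k (ball k (fun _ => 0) r).
Proof.
intros Hr HB Ha.
rewrite <- (vol_translate k B (ball k (fun _ => 0) r) (fun i => - a i)).
- apply vol_ext. intros x _. unfold ball.
  rewrite (nsq_ext k (fun i => - a i + x i - 0) (fun i => x i - a i)) by (intros; ring). tauto.
- apply ball_convex_in_box; [assumption|]. intros. rewrite Rabs_R0. lra.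
- intros j Hj. rewrite Ha by assumption. ring.
Qed.

(** The ball contains the cube of half-side [r / (k + 1)], because k < (k + 1)^2. *)
Lemma ball_vol_pos k r : 0 < r -> 0 < vol k (ball k (fun _ => 0) r).
Proof.
intros Hr. destruct (INR_unbounded r) as [B HB].
assert (Hk := pos_INR k).
set (q := r / (INR k + 1)).
assert (Hq : 0 < q) by (apply Rdiv_lt_0_compat; lra).
assert (Hqr : q * (INR k + 1) = r) by (unfold q; field; lra).
eapply Rlt_le_trans; [|apply (vol_lower k B _ (fun _ => 0) q)].
- apply pow_lt. lra.
- apply ball_convex_in_box; [lra|]. intros. rewrite Rabs_R0. lra.
- lra.
- intros x _ H. unfold ball, nsq, dot.
  apply Rle_lt_trans with (rsum k (fun _ => q * q)).
  + apply rsum_le. intros i Hi. specialize (H i Hi). apply Rabs_le_inv in H. nra.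
  + rewrite rsum_const. nra.
Qed.

(** * Normalised lattice sums, dilates and rotated coordinates *)

Definition gint (k L : nat) (h : R) (f : Vec -> R) : R := h ^ k * lsum (grid k L h) f.

Lemma gint_le k L h f g : 0 < h ->
  (forall x, supp k x -> (forall i, (i < k)%nat -> Rabs (x i) <= h * INR L) -> f x <= g x) ->
  gint k L h f <= gint k L h g.
Proof.
intros Hh H. apply Rmult_le_compat_l; [apply pow_le; lra|]. apply lsum_le. intros x Hx.
apply grid_in in Hx; [|lra]. apply H; apply Hx.
Qed.

Lemma gint_ext k L h f g : 0 < h ->
  (forall x, supp k x -> f x = g x) -> gint k L h f = gint k L h g.
Proof.
intros Hh H. apply Rle_antisym; apply gint_le; auto; intros; rewrite H by assumption; lra.
Qed.

Lemma gint_plus k L h f g : gint k L h (fun x => f x + g x) = gint k L h f + gint k L h g.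
Proof. unfold gint. rewrite lsum_plus. ring. Qed.

Lemma gint_minus k L h f g : gint k L h (fun x => f x - g x) = gint k L h f - gint k L h g.
Proof. unfold gint. rewrite lsum_minus. ring. Qed.

Lemma gint_scal k L h c f : gint k L h (fun x => c * f x) = c * gint k L h f.
Proof. unfold gint. rewrite lsum_scal. ring. Qed.

Lemma gint_abs k L h f : 0 < h -> Rabs (gint k L h f) <= gint k L h (fun x => Rabs (f x)).
Proof.
intros Hh. unfold gint. rewrite Rabs_mult, (Rabs_pos_eq (h ^ k)) by (apply pow_le; lra).
apply Rmult_le_compat_l; [apply pow_le; lra|apply lsum_abs].
Qed.

Lemma gint_swap k L h f :
  gint k L h (fun x => gint k L h (fun y => f x y)) = gint k L h (fun y => gint k L h (fun x => f x y)).
Proof.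
unfold gint. rewrite !lsum_scal, lsum_swap. reflexivity.
Qed.

Lemma gint_const k B L h c : 0 < h <= 1 -> h * INR L = INR B -> 0 <= c ->
  gint k L h (fun _ => c) <= (2 * INR B + 1) ^ k * c.
Proof.
intros Hh HL Hc. unfold gint. rewrite lsum_const, length_grid, <- Rmult_assoc, <- Rpow_mult_distr.
apply Rmult_le_compat_r; [assumption|]. assert (Q := pos_INR L).
apply pow_incr. split; [nra|]. rewrite <- HL. nra.
Qed.

Lemma gint_bound k B L h f M : 0 < h <= 1 -> h * INR L = INR B -> 0 <= M ->
  (forall x, supp k x -> Rabs (f x) <= M) -> Rabs (gint k L h f) <= (2 * INR B + 1) ^ k * M.
Proof.
intros Hh HL HM H. eapply Rle_trans; [apply gint_abs; lra|].
eapply Rle_trans; [|apply (gint_const k B L h); assumption].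
apply gint_le; [lra|]. intros. apply H; assumption.
Qed.

Lemma pow_diff_bound k e : 0 <= e <= 1 -> (1 + e) ^ k - (1 - e) ^ k <= e * 2 ^ (S k).
Proof.
intros He. induction k as [|k IH]; [simpl; lra|].
assert (H1 : (1 + e) ^ k <= 2 ^ k) by (apply pow_incr; lra).
assert (H2 : (1 - e) ^ k <= 1 ^ k) by (apply pow_incr; lra).
rewrite pow1 in H2. assert (H3 : 1 <= 2 ^ k) by (apply pow_R1_Rle; lra).
assert (H4 : 0 <= (1 - e) ^ k) by (apply pow_le; lra).
simpl in *. nra.
Qed.

Lemma ind_true A x : A x -> ind A x = 1.
Proof. intros H. unfold ind. destruct excluded_middle_informative; tauto. Qed.

Lemma ind_false A x : ~ A x -> ind A x = 0.
Proof. intros H. unfold ind. destruct excluded_middle_informative; tauto. Qed.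

Definition dilate (c : R) (A : Vec -> Prop) : Vec -> Prop := fun x => A (fun i => / c * x i).

Lemma dilate_convex_in_box k B A c Rn : 0 < c -> 0 <= Rn -> convex_set k A ->
  (forall x, A x -> nsq k x <= Rn * Rn) -> c * Rn <= INR B -> convex_in_box k B (dilate c A).
Proof.
intros Hc HR C HA HB. split.
- intros x y t Hx Hy Ht. unfold dilate.
  replace (fun i => / c * (t * x i + (1 - t) * y i))
    with (fun i => t * (/ c * x i) + (1 - t) * (/ c * y i)) by (extensionality i; ring).
  apply C; assumption.
- intros x Hx i Hi. apply HA in Hx. apply (nsq_coord_abs k _ i _ Hi HR) in Hx. cbv beta in Hx.
  rewrite Rabs_mult, (Rabs_pos_eq (/ c)) in Hx by (left; apply Rinv_0_lt_compat; assumption).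
  apply Rmult_le_compat_l with (r := c) in Hx; [|lra].
  rewrite <- Rmult_assoc, Rinv_r, Rmult_1_l in Hx by lra. lra.
Qed.

Lemma dilate_vol k B A c Rn : 0 < c -> 0 <= Rn -> convex_set k A ->
  (forall x, A x -> nsq k x <= Rn * Rn) -> Rn <= INR B -> vol k (dilate c A) = c ^ k * vol k A.
Proof.
intros Hc HR C HA HB. unfold dilate.
assert (convex_in_box k B A).
{ split; [assumption|]. intros x Hx i Hi. apply HA in Hx.
  apply (nsq_coord_abs k _ i _ Hi HR) in Hx. lra. }
rewrite (vol_scale k B) by (auto; apply Rinv_0_lt_compat; assumption).
rewrite pow_inv. field. apply pow_nonzero. lra.
Qed.

(** [a - y] has norm below [e * rho], so it lies in [e] times the ball contained in [A]; by
    convexity the sum of [A] and [e A] is [(1 + e) A]. *)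
Lemma near_dilate k A rho e a y : 0 < rho -> 0 < e -> convex_set k A ->
  (forall x, supp k x -> nsq k x < rho * rho -> A x) ->
  supp k a -> supp k y -> A y ->
  nsq k (fun i => a i - y i) < (e * rho) * (e * rho) -> dilate (1 + e) A a.
Proof.
intros Hr He C Hball Sa Sy Ay H. unfold dilate.
replace (fun i => / (1 + e) * a i) with
  (fun i => / (1 + e) * y i + (1 - / (1 + e)) * (/ e * (a i - y i))).
- apply C; [assumption| |].
  + apply Hball.
    * intros j Hj. rewrite Sa, Sy by assumption. ring.
    * rewrite nsq_scal. assert (/ e * / e * (e * rho * (e * rho)) = rho * rho) by (field; lra).
      rewrite <- H0. apply Rmult_lt_compat_l; [|assumption].
      assert (0 < / e) by (apply Rinv_0_lt_compat; lra). nra.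
  + assert (0 < / (1 + e)) by (apply Rinv_0_lt_compat; lra).
    assert (/ (1 + e) * (1 + e) = 1) by (field; lra). nra.
- extensionality i. field. lra.
Qed.

Lemma dilate_mono k A c d x : 0 < c <= d -> convex_set k A -> A (fun _ => 0) ->
  dilate c A x -> dilate d A x.
Proof.
intros Hcd C A0 H. unfold dilate in *.
replace (fun i => / d * x i) with (fun i => (c / d) * (/ c * x i) + (1 - c / d) * 0).
- apply (C _ (fun _ => 0)); [assumption|assumption|].
  assert (E : c / d * d = c) by (field; lra).
  assert (0 <= c / d) by (apply Rle_mult_inv_pos; lra). nra.
- extensionality i. field. lra.
Qed.

Definition coords (k : nat) (b : nat -> Vec) (x : Vec) : Vec :=
  fun i => if Nat.ltb i k then dot k x (b i) else 0.

Lemma coords_supp k b x : supp k (coords k b x).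
Proof. intros j Hj. unfold coords. destruct (Nat.ltb_spec j k); [lia|reflexivity]. Qed.

Lemma lincomb_coords k b x : orthonormal k k b -> supp k x -> lincomb k b (coords k b x) = x.
Proof.
intros O Hx. rewrite <- (orthonormal_complete k b x O Hx) at 2.
apply lincomb_eq; [|auto]. intros i Hi. unfold coords.
destruct (Nat.ltb_spec i k); [reflexivity|lia].
Qed.

Lemma nsq_lincomb n k b z : orthonormal n k b -> nsq n (lincomb k b z) = nsq k z.
Proof. intros O. apply dot_lincomb, O. Qed.

Lemma nsq_coords k b x : orthonormal k k b -> supp k x -> nsq k (coords k b x) = nsq k x.
Proof.
intros O Hx. rewrite <- (nsq_lincomb k k b), lincomb_coords by assumption. reflexivity.
Qed.

(** An orthogonal change of basis is an isometry, so nearness of [a] and the rotated point can be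
    read in the coordinates of either grid. This is what allows the pairs to be summed in both
    orders. *)
Lemma ball_sym k b a z r : orthonormal k k b -> supp k a ->
  (ball k (lincomb k b z) r a <-> ball k (coords k b a) r z).
Proof.
intros O Ha. unfold ball.
rewrite <- (nsq_lincomb k k b (fun i => z i - coords k b a i)) by assumption.
replace (fun i => z i - coords k b a i) with (fun i => 1 * z i + (-1) * coords k b a i)
  by (extensionality i; ring).
rewrite lincomb_lin, lincomb_coords by assumption.
rewrite nsq_sub_sym.
rewrite (nsq_ext k (fun j => 1 * lincomb k b z j + -1 * a j) (fun j => lincomb k b z j - a j))
  by (intros; ring). tauto.
Qed.

Lemma ball_gint k B L h a r : 0 < h <= 1 -> h * INR L = INR B -> 0 <= r -> r <= INR B ->
  supp k a -> (forall i, (i < k)%nat -> Rabs (a i) + r <= INR B) ->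
  Rabs (gint k L h (ind (ball k a r)) - vol k (ball k (fun _ => 0) r)) <= vol_error k B * h.
Proof.
intros Hh HL Hr HrB Ha Hb. rewrite <- (ball_vol k B a r) by assumption.
apply vol_approx; auto. apply ball_convex_in_box; assumption.
Qed.

(* Double counting of the pairs at distance less than [r] between the standard and the rotated
   grid: summing first over either grid produces the volume of a ball of radius [r]. *)
Lemma rotation_step k b A rho Rn e (B L : nat) h psi M Lam :
  orthonormal k k b -> convex_set k A -> 0 < rho <= 1 -> 0 < e <= 1 / 2 -> 0 <= Rn ->
  (forall x, supp k x -> nsq k x < rho * rho -> A x) ->
  (forall x, A x -> nsq k x <= Rn * Rn) -> 2 * Rn + 2 <= INR B ->
  0 <= M -> 0 <= Lam -> (forall x, supp k x -> A x -> Rabs (psi x) <= M) ->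
  (forall x y r, 0 < r -> supp k x -> supp k y -> A x -> A y ->
     nsq k (fun i => x i - y i) < r * r -> Rabs (psi x - psi y) <= Lam * r) ->
  0 < h <= 1 -> h * INR L = INR B ->
  let T := (2 * INR B + 1) ^ k in
  let om := vol k (ball k (fun _ => 0) (e * rho)) in
  let C := vol_error k B in
  om * Rabs (gint k L h (fun x => ind A x * psi x)
             - gint k L h (fun z => ind A (lincomb k b z) * psi (lincomb k b z)))
  <= 2 * (T * (M * (C * h)))
     + (om + C * h) * (Lam * (e * rho) * T + M * (((1 + e) ^ k - (1 - e) ^ k) * vol k A + 2 * (C * h))).
Proof.
intros O CA Hrho He HRn Hball HRA HB HM HLam Hpsi Hlip Hh HL T om C.
set (r := e * rho) in *. assert (Hr : 0 < r <= 1) by (unfold r; nra).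
set (g := fun x => ind A x * psi x). set (g' := fun z => ind A (lincomb k b z) * psi (lincomb k b z)).
set (chi := fun a z => ind (ball k (lincomb k b z) r) a).
assert (HCh : 0 <= C * h) by (apply Rmult_le_pos; [apply vol_error_nonneg|lra]).
assert (A0 : A (fun _ => 0)).
{ apply Hball; [intros j _; reflexivity|]. unfold nsq, dot. rewrite rsum_zero by (intros; ring). nra. }
assert (Hchi : forall a z, supp k a -> chi a z = ind (ball k (coords k b a) r) z).
{ intros a z Ha. unfold chi, ind. assert (S := ball_sym k b a z r O Ha).
  repeat destruct excluded_middle_informative; tauto. }
(* The radius [2 * Rn] allows for points [a] of the enlarged set [P]; together with [r <= 1] it fits
   in the box because [2 * Rn + 2 <= INR B]. *)
assert (Hsz : forall a, supp k a -> nsq k a <= (2 * Rn) * (2 * Rn) ->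
  Rabs (gint k L h (fun z => chi a z) - om) <= C * h).
{ intros a Ha Na. rewrite (gint_ext k L h _ (ind (ball k (coords k b a) r))) by (auto; lra).
  apply ball_gint; try lra; [apply coords_supp|].
  intros i Hi. rewrite <- (nsq_coords k b a O Ha) in Na.
  apply (nsq_coord_abs k _ i _ Hi) in Na; lra. }
assert (Hsa : forall z, nsq k z <= Rn * Rn -> Rabs (gint k L h (fun a => chi a z) - om) <= C * h).
{ intros z Nz. apply ball_gint; try lra; [apply lincomb_supp; assumption|].
  intros i Hi. rewrite <- (nsq_lincomb k k b z O) in Nz.
  apply (nsq_coord_abs k _ i _ Hi) in Nz; lra. }
assert (Hg : forall x, supp k x -> Rabs (g x) <= M * ind A x).
{ intros x Hx. unfold g. unfold ind. destruct excluded_middle_informative.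
  - rewrite Rmult_1_l, Rmult_1_r. auto.
  - rewrite Rmult_0_l, Rabs_R0. lra. }
assert (Hg' : forall z, Rabs (g' z) <= M * ind A (lincomb k b z)).
{ intros z. apply (Hg (lincomb k b z)). apply lincomb_supp; assumption. }
assert (S1 : Rabs (gint k L h (fun a => g a * (gint k L h (fun z => chi a z) - om))) <= T * (M * (C * h))).
{ apply gint_bound; auto; [nra|]. intros a Ha. rewrite Rabs_mult.
  specialize (Hg a Ha). unfold ind in Hg. destruct excluded_middle_informative as [Aa|_].
  - apply Rmult_le_compat; try apply Rabs_pos; [lra|]. apply Hsz; [assumption|].
    specialize (HRA a Aa). nra.
  - assert (Rabs (g a) = 0) by (assert (H := Rabs_pos (g a)); lra). rewrite H. nra. }
assert (S2 : Rabs (gint k L h (fun z => g' z * (gint k L h (fun a => chi a z) - om))) <= T * (M * (C * h))).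
{ apply gint_bound; auto; [nra|]. intros z _. rewrite Rabs_mult.
  specialize (Hg' z). unfold ind in Hg'. destruct excluded_middle_informative as [Az|_].
  - apply Rmult_le_compat; try apply Rabs_pos; [lra|]. apply Hsa.
    apply HRA in Az. rewrite nsq_lincomb in Az by assumption. exact Az.
  - assert (Rabs (g' z) = 0) by (assert (H := Rabs_pos (g' z)); lra). rewrite H. nra. }
(* A close pair with exactly one member in [A] has its standard member in the boundary layer between
   [Q] and [P], whose volume is small with [e]. *)
set (P := dilate (1 + e) A). set (Q := dilate (1 - e) A).
assert (HQA : forall x, Q x -> A x).
{ intros x Hx. apply (dilate_mono k A (1 - e) 1) in Hx; auto; [|lra]. unfold dilate in Hx.
  replace (fun i => / 1 * x i) with x in Hx; [assumption|]. extensionality i. field. }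
assert (HAP : forall x, A x -> P x).
{ intros x Hx. apply (dilate_mono k A 1 (1 + e)); auto; [lra|]. unfold dilate.
  replace (fun i => / 1 * x i) with x; [assumption|]. extensionality i. field. }
(* Bound for the discrepancy of a close pair: the oscillation of [psi] over distance [r] when both
   points are in [A], the maximum [M] in the boundary layer. *)
set (beta := fun a => Lam * r * ind A a + M * (ind P a - ind Q a)).
assert (Hbeta0 : forall a, 0 <= beta a).
{ intros a. unfold beta. assert (I := ind_bound A a).
  assert (ind Q a <= ind P a).
  { unfold ind. repeat destruct excluded_middle_informative; try lra. exfalso; auto. }
  assert (0 <= Lam * r) by nra. assert (0 <= Lam * r * ind A a) by (apply Rmult_le_pos; lra).
  assert (0 <= M * (ind P a - ind Q a)) by (apply Rmult_le_pos; lra). lra. }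
assert (Pt : forall a z, supp k a -> Rabs (g a - g' z) * chi a z <= beta a * chi a z).
{ intros a z Ha. unfold chi. unfold ind at 1 2. destruct excluded_middle_informative as [Hb|]; [|lra].
  rewrite !Rmult_1_r. set (y := lincomb k b z) in *.
  assert (Hy : supp k y) by (apply lincomb_supp; assumption).
  unfold ball in Hb.
  assert (Hgy : g' z = g y) by reflexivity. rewrite Hgy.
  destruct (classic (A a)) as [Aa|Na]; destruct (classic (A y)) as [Ay|Ny].
  - unfold g, beta. rewrite (ind_true A a), (ind_true A y) by assumption.
    rewrite !Rmult_1_l, Rmult_1_r.
    assert (H := Hlip a y r ltac:(lra) Ha Hy Aa Ay Hb).
    assert (ind Q a <= ind P a) by (rewrite (ind_true P) by auto; apply ind_bound).
    assert (0 <= M * (ind P a - ind Q a)) by (apply Rmult_le_pos; lra). lra.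
  - assert (NQ : ~ Q a).
    { intros Qa. apply Ny. unfold Q, dilate in Qa.
      (* If [a] were in [(1 - e) A], then [y], at distance below [e * rho] from it, would be in
         [A]. *)
      replace y with (fun i => (1 - e) * (/ (1 - e) * a i) + (1 - (1 - e)) * (/ e * (y i - a i))).
      - apply CA; [assumption| |lra]. apply Hball.
        + intros j Hj. rewrite Ha, Hy by assumption. ring.
        + rewrite nsq_scal, nsq_sub_sym.
          assert (E : / e * / e * (r * r) = rho * rho) by (unfold r; field; lra).
          rewrite <- E. apply Rmult_lt_compat_l; [|assumption].
          assert (0 < / e) by (apply Rinv_0_lt_compat; lra). nra.
      - extensionality i. field. lra. }
    specialize (Hg a Ha). rewrite ind_true in Hg by assumption.
    unfold beta. rewrite (ind_true P), (ind_false Q), (ind_true A a) by auto.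
    replace (g y) with 0 by (unfold g; rewrite ind_false by assumption; ring).
    rewrite Rminus_0_r. nra.
  - assert (Pa : P a).
    { apply (near_dilate k A rho e a y); auto; lra. }
    assert (NQ : ~ Q a) by auto.
    specialize (Hg y Hy). rewrite ind_true in Hg by assumption.
    unfold beta. rewrite (ind_true P), (ind_false Q), (ind_false A a) by auto.
    replace (g a) with 0 by (unfold g; rewrite ind_false by assumption; ring).
    unfold Rminus. rewrite Rplus_0_l, Rabs_Ropp. lra.
  - unfold g. rewrite (ind_false A a), (ind_false A y) by assumption.
    rewrite !Rmult_0_l, Rminus_diag, Rabs_R0. apply Hbeta0. }
assert (S3 : Rabs (gint k L h (fun a => gint k L h (fun z => (g a - g' z) * chi a z)))
  <= (om + C * h) * (Lam * r * T + M * (((1 + e) ^ k - (1 - e) ^ k) * vol k A + 2 * (C * h)))).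
{ eapply Rle_trans; [apply gint_abs; lra|].
  apply Rle_trans with (gint k L h (fun a => (om + C * h) * beta a)).
  - apply gint_le; [lra|]. intros a Ha _.
    eapply Rle_trans; [apply gint_abs; lra|].
    apply Rle_trans with (gint k L h (fun z => beta a * chi a z)).
    + apply gint_le; [lra|]. intros z _ _. rewrite Rabs_mult, (Rabs_pos_eq (chi a z)) by apply ind_bound.
      apply Pt; assumption.
    + rewrite gint_scal. rewrite (Rmult_comm (om + C * h)).
      destruct (classic (P a)) as [Pa|NP].
      * apply Rmult_le_compat_l; [apply Hbeta0|].
        assert (Na : nsq k a <= (2 * Rn) * (2 * Rn)).
        { unfold P, dilate in Pa. apply HRA in Pa. rewrite nsq_scal in Pa.
          assert (E : nsq k a = (1 + e) * (1 + e) * (/ (1 + e) * / (1 + e) * nsq k a)) by (field; lra).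
          rewrite E. assert (0 <= (1 + e) * (1 + e) <= 4) by nra.
          assert (0 <= Rn * Rn) by nra.
          apply Rle_trans with (4 * (Rn * Rn)); [|lra].
          apply Rmult_le_compat; try lra. rewrite <- nsq_scal. apply nsq_nonneg. }
        specialize (Hsz a Ha Na). apply Rabs_le_inv in Hsz.
        apply Rle_trans with (gint k L h (fun z => chi a z)); [apply Rle_refl|lra].
      * assert (beta a = 0).
        { unfold beta. rewrite (ind_false A a), (ind_false P), (ind_false Q) by auto. ring. }
        rewrite H. lra.
  - rewrite gint_scal. apply Rmult_le_compat_l.
    + assert (0 < om) by (apply ball_vol_pos; lra). lra.
    + unfold beta. rewrite gint_plus, !gint_scal, gint_minus.
      assert (0 <= e * Rn) by (apply Rmult_le_pos; lra).
      assert (e * Rn <= 1 * Rn) by (apply Rmult_le_compat_r; lra).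
      assert (CP : convex_in_box k B P) by (apply (dilate_convex_in_box k B A (1 + e) Rn); auto; lra).
      assert (CQ : convex_in_box k B Q) by (apply (dilate_convex_in_box k B A (1 - e) Rn); auto; lra).
      assert (VP := vol_approx k B P h L CP Hh HL). assert (VQ := vol_approx k B Q h L CQ Hh HL).
      unfold P in VP at 2. unfold Q in VQ at 2.
      rewrite (dilate_vol k B A _ Rn) in VP by (auto; lra).
      rewrite (dilate_vol k B A _ Rn) in VQ by (auto; lra).
      apply Rabs_le_inv in VP. apply Rabs_le_inv in VQ. fold C in VP, VQ.
      fold (gint k L h (ind P)) in VP. fold (gint k L h (ind Q)) in VQ.
      assert (GA : gint k L h (ind A) <= T).
      { eapply Rle_trans; [apply (gint_le k L h _ (fun _ => 1)); [lra|intros; apply ind_bound]|].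
        eapply Rle_trans; [apply (gint_const k B L h 1); lra|]. fold T. lra. }
      apply Rplus_le_compat; apply Rmult_le_compat_l; try lra.
      apply Rmult_le_pos; lra. }
(* Both sums are multiplied by the ball volume [om]; replacing [om] by the actual number of partners
   of each point gives the double sum, with one correction for each grid. *)
assert (E : om * (gint k L h g - gint k L h g') =
  gint k L h (fun a => gint k L h (fun z => (g a - g' z) * chi a z))
  - gint k L h (fun a => g a * (gint k L h (fun z => chi a z) - om))
  + gint k L h (fun z => g' z * (gint k L h (fun a => chi a z) - om))).
{ rewrite (gint_ext k L h (fun a => gint k L h (fun z => (g a - g' z) * chi a z))
    (fun a => g a * gint k L h (fun z => chi a z) - gint k L h (fun z => g' z * chi a z))).
  2: lra.
  2:{ intros a _. rewrite <- gint_scal, <- gint_minus. apply gint_ext; [lra|]. intros; ring. }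
  rewrite (gint_ext k L h (fun a => g a * (gint k L h (fun z => chi a z) - om))
    (fun a => g a * gint k L h (fun z => chi a z) - om * g a)) by (lra || (intros; ring)).
  rewrite (gint_ext k L h (fun z => g' z * (gint k L h (fun a => chi a z) - om))
    (fun z => gint k L h (fun a => g' z * chi a z) - om * g' z))
    by (lra || (intros; rewrite gint_scal; ring)).
  rewrite !gint_minus, !gint_scal.
  rewrite (gint_swap k L h (fun x y => g' y * chi x y)). ring. }
assert (Hom : 0 < om) by (apply ball_vol_pos; lra).
rewrite <- (Rabs_pos_eq om) at 1 by lra. rewrite <- Rabs_mult, E.
apply Rabs_le_inv in S1. apply Rabs_le_inv in S2. apply Rabs_le_inv in S3.
apply Rabs_le. lra.
Qed.

(** * Volumes and centroids in rotated coordinates *)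

Definition mesh (N : nat) : R := / INR (N + 1).

Lemma mesh_bounds N : 0 < mesh N <= 1.
Proof.
split; [apply inv_INR_pos|]. unfold mesh. rewrite <- Rinv_1 at 1.
apply Rinv_le_contravar; [lra|]. replace 1 with (INR 1) by reflexivity. apply le_INR. lia.
Qed.

Lemma mesh_cover B N : mesh N * INR (B * (N + 1)) = INR B.
Proof. unfold mesh. rewrite mult_INR. field. apply not_0_INR. lia. Qed.

Lemma Un_cv_rate u l C : (forall N, Rabs (u N - l) <= C * mesh N) -> Un_cv u l.
Proof.
intros H eps He. assert (HC := Rabs_pos C). assert (HC' := Rle_abs C).
destruct (inv_small (eps / (Rabs C + 1))) as [N0 H0]; [apply Rdiv_lt_0_compat; lra|].
exists N0. intros N HN. specialize (H0 N HN). specialize (H N). unfold Rdist.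
fold (mesh N) in H0. assert (P := mesh_bounds N).
assert (eps / (Rabs C + 1) * (Rabs C + 1) = eps) by (field; lra). nra.
Qed.

Lemma Un_cv_ext u v l : (forall N, u N = v N) -> Un_cv u l -> Un_cv v l.
Proof.
intros H Hu eps He. destruct (Hu eps He) as [N0 H0]. exists N0. intros N HN.
rewrite <- H. apply H0. assumption.
Qed.

Lemma Un_cv_const c : Un_cv (fun _ => c) c.
Proof. intros eps He. exists 0%nat. intros. unfold Rdist. rewrite Rminus_diag, Rabs_R0. lra. Qed.

Lemma Un_cv_scal u l c : Un_cv u l -> Un_cv (fun N => c * u N) (c * l).
Proof. intros H. apply (CV_mult (fun _ => c)); [apply Un_cv_const|assumption]. Qed.

Lemma is_int_grid k A f v : is_int k A f v ->
  exists B : nat, (forall x, A x -> forall i, (i < k)%nat -> Rabs (x i) <= INR B) /\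
  Un_cv (fun N => gint k (B * (N + 1)) (mesh N) (fun x => ind A x * f x)) v.
Proof.
intros [B [HB H]]. exists B. split; [assumption|]. revert H. apply Un_cv_ext. intros N. cbv zeta.
unfold gint. rewrite <- gridsum_grid. unfold Rdiv. rewrite Rmult_comm, <- pow_inv. fold (mesh N).
f_equal. f_equal. extensionality z.
replace (fun i => mesh N * z i) with (fun i => z i * mesh N) by (extensionality i; ring).
reflexivity.
Qed.

Lemma vol_cv k B A : convex_in_box k B A -> Un_cv (fun N => gint k (B * (N + 1)) (mesh N) (ind A)) (vol k A).
Proof.
intros H. apply Un_cv_rate with (vol_error k B). intros N.
apply vol_approx; [assumption|apply mesh_bounds|apply mesh_cover].
Qed.

Lemma is_vol_vol k A v : convex_set k A -> is_vol k A v -> v = vol k A.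
Proof.
intros C H. apply is_int_grid in H. destruct H as [B [HB H]].
apply (UL_sequence (fun N => gint k (B * (N + 1)) (mesh N) (ind A))).
- revert H. apply Un_cv_ext. intros N. apply gint_ext; [apply mesh_bounds|]. intros; ring.
- apply vol_cv. split; assumption.
Qed.

Lemma pts_extend1 h L g : 0 < h -> (forall s, h * INR L < Rabs s -> g s = 0) ->
  lsum (pts 0 h (S L)) g = lsum (pts 0 h L) g.
Proof.
intros Hh H. rewrite !pts_seq.
replace (2 * S L + 1)%nat with (S (S (2 * L + 1))) by lia.
rewrite (seq_S (S (2 * L + 1))), lsum_app, lsum_1.
change (seq 0 (S (2 * L + 1))) with (0%nat :: seq 1 (2 * L + 1)).
rewrite lsum_cons, <- seq_shift, lsum_map.
assert (PL := pos_INR L).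
rewrite (H (0 - h * INR (S L) + h * INR 0)).
2:{ rewrite S_INR. simpl (INR 0). rewrite Rabs_left; nra. }
rewrite (H (0 - h * INR (S L) + h * INR (0 + S (2 * L + 1)))).
2:{ rewrite plus_INR, !S_INR, plus_INR, mult_INR. simpl. rewrite Rabs_right; nra. }
rewrite Rplus_0_l, Rplus_0_r. apply lsum_ext. intros j _. f_equal. rewrite !S_INR. ring.
Qed.

Lemma pts_extend h L L' g : 0 < h -> (L <= L')%nat -> (forall s, h * INR L < Rabs s -> g s = 0) ->
  lsum (pts 0 h L') g = lsum (pts 0 h L) g.
Proof.
intros Hh HL H. induction HL as [|L' HL IH]; [reflexivity|].
rewrite pts_extend1; [assumption|assumption|].
intros s Hs. apply H. assert (INR L <= INR L') by (apply le_INR; lia). nra.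
Qed.

Lemma gint_extend k h L L' f : 0 < h -> (L <= L')%nat ->
  (forall x i, (i < k)%nat -> h * INR L < Rabs (x i) -> f x = 0) ->
  gint k L' h f = gint k L h f.
Proof.
intros Hh HL H. unfold gint. f_equal. revert f H. induction k as [|k IH]; intros f H; [reflexivity|].
rewrite !lsum_grid_S.
rewrite (lsum_ext _ _ _ (fun s => lsum (grid k L h) (fun x => f (upd x k s)))).
- apply pts_extend; auto. intros s Hs. apply lsum_zero. intros x _.
  apply (H _ k); [lia|]. rewrite upd_same. assumption.
- intros s _. apply IH. intros x i Hi Hx. apply (H _ i); [lia|]. rewrite upd_other by lia. assumption.
Qed.

(** [is_int] only provides some box. Sums over two boxes that both contain [A] differ by zero terms,
    so any convenient box may be used. *)
Lemma is_int_any_grid k A f v B : is_int k A f v ->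
  (forall x, A x -> forall i, (i < k)%nat -> Rabs (x i) <= INR B) ->
  Un_cv (fun N => gint k (B * (N + 1)) (mesh N) (fun x => ind A x * f x)) v.
Proof.
intros H HB. apply is_int_grid in H. destruct H as [B0 [HB0 H]].
revert H. apply Un_cv_ext. intros N. assert (P := mesh_bounds N).
assert (E : forall B', (forall x, A x -> forall i, (i < k)%nat -> Rabs (x i) <= INR B') ->
  forall x i, (i < k)%nat -> mesh N * INR (B' * (N + 1)) < Rabs (x i) -> ind A x * f x = 0).
{ intros B' HB' x i Hi Hx. rewrite mesh_cover in Hx. rewrite ind_false; [ring|].
  intros Ax. specialize (HB' x Ax i Hi). lra. }
destruct (Nat.le_ge_cases B0 B).
- symmetry. apply gint_extend; [lra|apply Nat.mul_le_mono_r; assumption|apply E; assumption].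
- apply gint_extend; [lra|apply Nat.mul_le_mono_r; assumption|apply E; assumption].
Qed.

(** The order of choice matters: [e] is fixed first, making oscillation and boundary layer small;
    only then is the mesh taken small compared with [om], which depends on [e]. *)
Lemma rotation_cv k b A rho Rn (B : nat) psi M Lam :
  orthonormal k k b -> convex_set k A -> 0 < rho <= 1 -> 0 <= Rn ->
  (forall x, supp k x -> nsq k x < rho * rho -> A x) ->
  (forall x, A x -> nsq k x <= Rn * Rn) -> 2 * Rn + 2 <= INR B ->
  0 <= M -> 0 <= Lam -> (forall x, supp k x -> A x -> Rabs (psi x) <= M) ->
  (forall x y r, 0 < r -> supp k x -> supp k y -> A x -> A y ->
     nsq k (fun i => x i - y i) < r * r -> Rabs (psi x - psi y) <= Lam * r) ->
  Un_cv (fun N => gint k (B * (N + 1)) (mesh N) (fun x => ind A x * psi x)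
    - gint k (B * (N + 1)) (mesh N) (fun z => ind A (lincomb k b z) * psi (lincomb k b z))) 0.
Proof.
intros O CA Hrho HRn Hball HRA HB HM HLam Hpsi Hlip eta Heta.
set (T := (2 * INR B + 1) ^ k). set (C := vol_error k B).
assert (HC : 0 <= C) by apply vol_error_nonneg.
assert (PB := pos_INR B).
assert (HT : 0 <= T) by (apply pow_le; lra).
assert (CB : convex_in_box k B A).
{ split; [assumption|]. intros x Hx i Hi. apply HRA in Hx.
  apply (nsq_coord_abs k _ i _ Hi HRn) in Hx. lra. }
assert (HV := proj1 (vol_bound k B A CB)).
set (Y := Lam * rho * T + M * (2 ^ (S k) * vol k A)).
assert (P2 : 0 < 2 ^ (S k)) by (apply pow_lt; lra).
assert (HY : 0 <= Y).
{ unfold Y. assert (0 <= Lam * rho) by nra. assert (0 <= Lam * rho * T) by (apply Rmult_le_pos; lra).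
  assert (0 <= 2 ^ (S k) * vol k A) by (apply Rmult_le_pos; lra).
  assert (0 <= M * (2 ^ (S k) * vol k A)) by (apply Rmult_le_pos; lra). lra. }
set (e := Rmin (1 / 2) (eta / (4 * (Y + 1)))).
assert (He0 : 0 < eta / (4 * (Y + 1))) by (apply Rdiv_lt_0_compat; lra).
assert (He : 0 < e <= 1 / 2) by (split; [apply Rmin_glb_lt; lra|apply Rmin_l]).
assert (HeY : e * Y <= eta / 4).
{ assert (e <= eta / (4 * (Y + 1))) by apply Rmin_r.
  assert (eta / (4 * (Y + 1)) * (Y + 1) = eta / 4) by (field; lra). nra. }
set (om := vol k (ball k (fun _ => 0) (e * rho))).
assert (Hom : 0 < om) by (apply ball_vol_pos; nra).
(* [K] collects the coefficients of all terms that carry a factor [h], using [h <= 1] for the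
   quadratic one. *)
set (K := 2 * (T * (M * C)) + C * (e * Y) + 2 * om * (M * C) + 2 * C * (M * C)).
assert (HMC : 0 <= M * C) by (apply Rmult_le_pos; lra).
assert (HTMC : 0 <= T * (M * C)) by (apply Rmult_le_pos; lra).
assert (HCMC : 0 <= C * (M * C)) by (apply Rmult_le_pos; lra).
assert (HeY0 : 0 <= e * Y) by (apply Rmult_le_pos; lra).
assert (HCY : 0 <= C * (e * Y)) by (apply Rmult_le_pos; lra).
assert (HomMC : 0 <= om * (M * C)) by (apply Rmult_le_pos; lra).
assert (HK : 0 <= K) by (unfold K; lra).
destruct (inv_small (eta * om / (4 * (K + 1)))) as [N0 HN0].
{ apply Rdiv_lt_0_compat; nra. }
exists N0. intros N HN. specialize (HN0 N HN). fold (mesh N) in HN0.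
set (h := mesh N) in *. assert (Hh : 0 < h <= 1) by apply mesh_bounds.
assert (S := rotation_step k b A rho Rn e B (B * (N + 1)) h psi M Lam O CA Hrho He HRn Hball HRA HB
  HM HLam Hpsi Hlip Hh (mesh_cover B N)). cbv zeta in S. fold om T C in S.
unfold Rdist. rewrite Rminus_0_r. set (W := Rabs _) in *.
assert (PD := pow_diff_bound k e ltac:(lra)).
assert (X1 : Lam * (e * rho) * T + M * (((1 + e) ^ k - (1 - e) ^ k) * vol k A + 2 * (C * h))
  <= e * Y + 2 * (M * C) * h).
{ assert (((1 + e) ^ k - (1 - e) ^ k) * vol k A <= e * 2 ^ Datatypes.S k * vol k A)
    by (apply Rmult_le_compat_r; lra).
  assert (M * (((1 + e) ^ k - (1 - e) ^ k) * vol k A) <= M * (e * 2 ^ Datatypes.S k * vol k A))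
    by (apply Rmult_le_compat_l; lra).
  unfold Y. lra. }
assert (HCh : 0 <= C * h) by (apply Rmult_le_pos; lra).
assert (X2 : om * W <= om * (e * Y) + K * h).
{ eapply Rle_trans; [apply S|].
  apply Rle_trans with (2 * (T * (M * (C * h))) + (om + C * h) * (e * Y + 2 * (M * C) * h)).
  - apply Rplus_le_compat_l, Rmult_le_compat_l; lra.
  - unfold K. assert (C * h * (2 * (M * C) * h) <= 2 * C * (M * C) * h).
    { assert (C * (M * C) * (h * h) <= C * (M * C) * h) by (apply Rmult_le_compat_l; nra). lra. }
    lra. }
assert (X3 : K * h <= om * (eta / 4)).
{ assert (eta * om / (4 * (K + 1)) * (K + 1) = om * (eta / 4)) by (field; lra). nra. }
assert (X4 : om * W <= om * (eta / 2)) by nra.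
apply Rmult_le_reg_l in X4; lra.
Qed.

Lemma convex_in_box_rotated n k B b A Rn : orthonormal n k b -> 0 <= Rn -> convex_set n A ->
  (forall x, A x -> nsq n x <= Rn * Rn) -> Rn <= INR B ->
  convex_in_box k B (fun t => A (lincomb k b t)).
Proof.
intros O HR C HA HB. split.
- intros x y t Hx Hy Ht. rewrite lincomb_lin. apply C; assumption.
- intros x Hx i Hi. apply HA in Hx. rewrite nsq_lincomb in Hx by assumption.
  apply (nsq_coord_abs k _ i _ Hi HR) in Hx. lra.
Qed.

Lemma vol_rotation k b A rho Rn : orthonormal k k b -> convex_set k A -> 0 < rho -> 0 <= Rn ->
  (forall x, supp k x -> nsq k x < rho * rho -> A x) ->
  (forall x, A x -> nsq k x <= Rn * Rn) ->
  vol k (fun t => A (lincomb k b t)) = vol k A.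
Proof.
intros O CA Hrho HRn Hball HRA.
destruct (INR_unbounded (2 * Rn + 2)) as [B HB].
assert (Hm1 := Rmin_l rho 1). assert (Hm2 := Rmin_r rho 1).
assert (Hm : 0 < Rmin rho 1) by (apply Rmin_glb_lt; lra).
assert (R := rotation_cv k b A (Rmin rho 1) Rn B (fun _ => 1) 1 0 O CA (conj Hm Hm2) HRn).
assert (C1 := vol_cv k B (fun t => A (lincomb k b t))
  (convex_in_box_rotated k k B b A Rn O HRn CA HRA ltac:(lra))).
assert (CB : convex_in_box k B A).
{ split; [assumption|]. intros x Hx i Hi. apply HRA in Hx.
  apply (nsq_coord_abs k _ i _ Hi HRn) in Hx. lra. }
assert (C2 := vol_cv k B A CB).
assert (E := CV_minus _ _ _ _ C2 C1).
assert (Z : vol k A - vol k (fun t => A (lincomb k b t)) = 0); [|lra].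
apply (UL_sequence _ _ _ E).
refine (Un_cv_ext _ _ _ _ (R _ HRA _ _ _ _ _)); try lra.
- intros N. cbv beta. f_equal; apply gint_ext; try apply mesh_bounds; intros; rewrite Rmult_1_r; reflexivity.
- intros x Sx Hx. apply Hball; [assumption|]. nra.
- intros. rewrite Rabs_R1. lra.
- intros. rewrite Rminus_diag, Rabs_R0. lra.
Qed.

Lemma centroid_linear k A B (a : Vec) :
  (forall j, (j < k)%nat -> is_int k A (fun x => x j) 0) ->
  (forall x, A x -> forall i, (i < k)%nat -> Rabs (x i) <= INR B) ->
  Un_cv (fun N => gint k (B * (N + 1)) (mesh N) (fun x => ind A x * dot k a x)) 0.
Proof.
intros H HB. unfold dot.
assert (K : forall m, (m <= k)%nat ->
  Un_cv (fun N => gint k (B * (N + 1)) (mesh N) (fun x => ind A x * rsum m (fun i => a i * x i))) 0);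
  [|apply K; lia].
induction m as [|m IH]; intros Hm.
- apply (Un_cv_ext (fun _ => 0)); [|apply Un_cv_const]. intros N.
  transitivity (gint k (B * (N + 1)) (mesh N) (fun x => 0 * ind A x)).
  + rewrite gint_scal. ring.
  + apply gint_ext; [apply mesh_bounds|]. intros; simpl; ring.
- replace 0 with (0 + a m * 0) by ring.
  refine (Un_cv_ext _ _ _ _ (CV_plus _ _ _ _ (IH ltac:(lia))
    (Un_cv_scal _ _ (a m) (is_int_any_grid k A _ _ B (H m ltac:(lia)) HB)))).
  intros N. cbv beta. rewrite <- gint_scal, <- gint_plus. apply gint_ext; [apply mesh_bounds|].
  intros; simpl; ring.
Qed.

Lemma dot_abs_bound k a x r : (forall i, (i < k)%nat -> Rabs (x i) <= r) ->
  Rabs (dot k a x) <= rsum k (fun i => Rabs (a i)) * r.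
Proof.
intros H. unfold dot. rewrite rsum_lsum. eapply Rle_trans; [apply lsum_abs|].
rewrite rsum_lsum, Rmult_comm, <- lsum_scal. apply lsum_le. intros i Hi. apply in_seq in Hi.
rewrite Rabs_mult, Rmult_comm. apply Rmult_le_compat_r; [apply Rabs_pos|]. apply H. lia.
Qed.

Lemma dot_minus_r k a x y : dot k a x - dot k a y = dot k a (fun i => x i - y i).
Proof. unfold dot. rewrite <- rsum_minus. apply rsum_ext. intros; ring. Qed.

(** The rotated coordinate [z j] is the scalar product of the point with [b j]. The standard moments
    of this linear functional tend to 0 by [centroid_linear], and [rotation_cv] transfers them to
    the rotated grid. *)
Lemma centroid_rotated k b A rho Rn B j :
  orthonormal k k b -> convex_set k A -> 0 < rho -> 0 <= Rn ->
  (forall x, supp k x -> nsq k x < rho * rho -> A x) ->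
  (forall x, A x -> nsq k x <= Rn * Rn) -> 2 * Rn + 2 <= INR B ->
  (forall j, (j < k)%nat -> is_int k A (fun x => x j) 0) -> (j < k)%nat ->
  Un_cv (fun N => gint k (B * (N + 1)) (mesh N) (fun z => ind A (lincomb k b z) * z j)) 0.
Proof.
intros O CA Hrho HRn Hball HRA HB Hc Hj.
assert (Hm1 := Rmin_l rho 1). assert (Hm2 := Rmin_r rho 1).
assert (Hm : 0 < Rmin rho 1) by (apply Rmin_glb_lt; lra).
set (Lam := rsum k (fun i => Rabs (b j i))).
assert (HLam : 0 <= Lam) by (apply rsum_nonneg; intros; apply Rabs_pos).
assert (HA : forall x, A x -> forall i, (i < k)%nat -> Rabs (x i) <= Rn).
{ intros x Hx i Hi. apply HRA in Hx. apply (nsq_coord_abs k _ i _ Hi HRn Hx). }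
assert (R := rotation_cv k b A (Rmin rho 1) Rn B (dot k (b j)) (Lam * Rn) Lam O CA (conj Hm Hm2) HRn).
assert (C := centroid_linear k A B (b j) Hc).
assert (HAB : forall x, A x -> forall i, (i < k)%nat -> Rabs (x i) <= INR B).
{ intros x Hx i Hi. specialize (HA x Hx i Hi). lra. }
specialize (C HAB).
replace 0 with (0 - 0) by ring.
refine (Un_cv_ext _ _ _ _ (CV_minus _ _ _ _ C (R _ HRA HB _ HLam _ _))).
- intros N. cbv beta. rewrite <- gint_minus, <- gint_minus. apply gint_ext; [apply mesh_bounds|].
  intros z _. rewrite (dot_comm k (b j) (lincomb k b z)), (dot_lincomb_basis k k b z j O Hj). ring.
- intros x Sx Hx. apply Hball; [assumption|]. nra.
- apply Rmult_le_pos; lra.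
- intros x _ Hx. apply dot_abs_bound. auto.
- intros x y r Hr _ _ _ _ Hxy. rewrite dot_minus_r. apply dot_abs_bound.
  intros i Hi. apply (nsq_coord_abs k (fun i => x i - y i) i r Hi); lra.
Qed.

(** * The centroid is an interior point *)

Lemma eventually_forall n (P : nat -> nat -> Prop) :
  (forall j, (j < n)%nat -> exists N0, forall N, (N >= N0)%nat -> P j N) ->
  exists N0, forall N, (N >= N0)%nat -> forall j, (j < n)%nat -> P j N.
Proof.
induction n as [|n IH]; intros H; [exists 0%nat; intros; lia|].
destruct IH as [N1 H1]; [intros; apply H; lia|]. destruct (H n ltac:(lia)) as [N2 H2].
exists (max N1 N2). intros N HN j Hj. destruct (Nat.eq_dec j n) as [->|].
- apply H2; lia.
- apply H1; lia.
Qed.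

(* Near [0], write y as an average of points of A: move only the lattice points lying in a small
   ball inside A, all by the same vector, so that the average changes from the centroid to y. *)
Lemma centroid_interior k A B x0 rho : convex_in_box k B A -> 0 < rho -> supp k x0 ->
  (forall y, supp k y -> nsq k (fun i => y i - x0 i) < rho * rho -> A y) ->
  (forall j, (j < k)%nat -> is_int k A (fun x => x j) 0) ->
  exists eta, 0 < eta /\ forall y, supp k y -> nsq k y < eta * eta -> A y.
Proof.
intros CB Hrho Sx0 Hball Hc. destruct (CB) as [CA HB].
set (r := rho / 2). assert (Hr : 0 < r) by (unfold r; lra).
set (om := vol k (ball k (fun _ => 0) r)). assert (Hom : 0 < om) by (apply ball_vol_pos; lra).
assert (Hk := pos_INR k).
set (c := r / (INR k + 1)). assert (Hcp : 0 < c) by (apply Rdiv_lt_0_compat; lra).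
assert (Hcr : c * (INR k + 1) = r) by (unfold c; field; lra).
assert (HV := proj1 (vol_bound k B A CB)).
(* With each moment below [d] and [y] within [d / W1] of 0, the numerator of [w i] is at most
   [2 * d = c * om / 2], while [Q > om / 2]; hence [Rabs (w i) <= c], and [c] is chosen so that this
   forces norm at most [r]. *)
set (W1 := vol k A + 1). set (d := c * om / 4). assert (Hd : 0 < d) by (unfold d; nra).
assert (CBl : convex_in_box k B (fun x => A x /\ ball k x0 r x)).
{ split.
  - intros x y t [H1 H2] [H3 H4] Ht. split; [apply CA; assumption|].
    apply (ball_convex k x0 r x y t); assumption.
  - intros x [Hx _]. apply HB. assumption. }
assert (HVb : vol k (fun x => A x /\ ball k x0 r x) = om).
{ destruct (INR_unbounded r) as [B' HB'].
  rewrite (vol_ext k _ (ball k x0 r)).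
  - apply (ball_vol k B'); try lra; assumption.
  - intros x Sx. split; [tauto|]. intros Hx. split; [|assumption]. apply Hball; [assumption|].
    unfold ball in Hx. unfold r in Hx. nra. }
assert (CV1 := vol_cv k B A CB). assert (CV2 := vol_cv k B _ CBl). rewrite HVb in CV2.
destruct (CV1 1 ltac:(lra)) as [N1 H1]. destruct (CV2 (om / 2) ltac:(lra)) as [N2 H2].
destruct (eventually_forall k (fun j N =>
  Rabs (gint k (B * (N + 1)) (mesh N) (fun x => ind A x * x j)) < d)) as [N3 H3].
{ intros j Hj. destruct (is_int_any_grid k A _ _ B (Hc j Hj) HB d Hd) as [N0 H0].
  exists N0. intros N HN. specialize (H0 N HN). unfold Rdist in H0. rewrite Rminus_0_r in H0. exact H0. }
set (N := max N1 (max N2 N3)).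
specialize (H1 N ltac:(lia)). specialize (H2 N ltac:(lia)). specialize (H3 N ltac:(lia)).
unfold Rdist in H1, H2. apply Rabs_def2 in H1. apply Rabs_def2 in H2.
set (h := mesh N) in *. assert (Hh : 0 < h <= 1) by apply mesh_bounds.
set (L := (B * (N + 1))%nat) in *.
set (W := gint k L h (ind A)) in *. set (Q := gint k L h (ind (fun x => A x /\ ball k x0 r x))) in *.
assert (HQW : Q <= W).
{ apply gint_le; [lra|]. intros x _ _. unfold ind.
  repeat destruct excluded_middle_informative; try lra; tauto. }
exists (d / W1). assert (HW1 : 0 < W1) by (unfold W1; lra).
assert (Heta : 0 < d / W1) by (apply Rdiv_lt_0_compat; lra). split; [assumption|].
intros y Sy Hy.
(* Solution of (sum of the lattice points) + [Q * w] = [W * y], where [Q] is the mass of the lattice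
   points that are moved. *)
set (w := fun i => (W * y i - gint k L h (fun x => ind A x * x i)) / Q).
assert (HQ : 0 < Q) by lra.
assert (Sw : supp k w).
{ intros j Hj. unfold w. rewrite Sy by assumption.
  rewrite (gint_ext k L h _ (fun x => 0 * ind A x)); [|lra|intros x Hx; rewrite Hx by assumption; ring].
  rewrite gint_scal. unfold Rdiv. ring. }
assert (Hw : nsq k w <= r * r).
{ apply Rle_trans with (rsum k (fun _ => c * c)).
  - apply rsum_le. intros i Hi.
    assert (Yi := nsq_coord_abs k y i (d / W1) Hi ltac:(lra) ltac:(lra)). specialize (H3 i Hi).
    assert (Rabs (w i) <= c).
    { unfold w, Rdiv. rewrite Rabs_mult, (Rabs_pos_eq (/ Q)) by (left; apply Rinv_0_lt_compat; lra).
      apply Rmult_le_reg_r with Q; [assumption|]. rewrite Rmult_assoc, Rinv_l, Rmult_1_r by lra.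
      unfold Rminus. eapply Rle_trans; [apply Rabs_triang|].
      rewrite Rabs_Ropp, Rabs_mult, (Rabs_pos_eq W) by lra.
      assert (W * Rabs (y i) <= W1 * (d / W1)).
      { apply Rmult_le_compat; try lra; [apply Rabs_pos | unfold W1; lra]. }
      assert (W1 * (d / W1) = d) by (field; lra).
      assert (2 * d = c * (om / 2)) by (unfold d; field). nra. }
    apply Rabs_le_inv in H. nra.
  - rewrite rsum_const. rewrite <- Hcr. nra. }
(* [None] records the mass and [Some i] the mass times coordinate [i]. The cone below consists of 0
   and of the data with positive mass and barycentre in [A]. *)
set (f := fun (x : Vec) (o : option nat) => h ^ k * match o with
  | None => ind A x
  | Some i => ind A x * x i + ind (fun x => A x /\ ball k x0 r x) x * w i end).
assert (Hhk : 0 < h ^ k) by (apply pow_lt; lra).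
assert (K := lsum_cone Vec (option nat) (fun a => (forall o, a o = 0) \/
  (0 < a None /\ A (fun i => a (Some i) / a None))) (grid k L h) f).
cbv beta in K.
assert (Tot : forall o, lsum (grid k L h) (fun x => f x o) = match o with
  | None => W | Some i => W * y i end).
{ intros [i|]; unfold f; rewrite lsum_scal.
  - fold (gint k L h (fun x => ind A x * x i + ind (fun x => A x /\ ball k x0 r x) x * w i)).
    rewrite gint_plus.
    rewrite (gint_ext k L h (fun x => ind (fun x => A x /\ ball k x0 r x) x * w i)
      (fun x => w i * ind (fun x => A x /\ ball k x0 r x) x)) by (lra || (intros; ring)).
    rewrite gint_scal. fold Q. unfold w. field. lra.
  - reflexivity. }
destruct K as [K|[K1 K2]].
- left. reflexivity.
- intros a a' [Ha|[Ha1 Ha2]] [Ha'|[Ha1' Ha2']].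
  + left. intros o. rewrite Ha, Ha'. ring.
  + right. rewrite Ha, Rplus_0_l. split; [assumption|].
    replace (fun i => (a (Some i) + a' (Some i)) / a' None) with (fun i => a' (Some i) / a' None);
      [assumption|]. extensionality i. rewrite Ha. rewrite Rplus_0_l. reflexivity.
  + right. rewrite Ha', Rplus_0_r. split; [assumption|].
    replace (fun i => (a (Some i) + a' (Some i)) / a None) with (fun i => a (Some i) / a None);
      [assumption|]. extensionality i. rewrite Ha'. rewrite Rplus_0_r. reflexivity.
  + right. split; [lra|].
    set (t := a None / (a None + a' None)).
    replace (fun i => (a (Some i) + a' (Some i)) / (a None + a' None)) with
      (fun i => t * (a (Some i) / a None) + (1 - t) * (a' (Some i) / a' None)).
    * apply CA; [assumption|assumption|].
      assert (t * (a None + a' None) = a None) by (unfold t; field; lra).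
      assert (0 <= t) by (apply Rle_mult_inv_pos; lra). nra.
    * extensionality i. unfold t. field. repeat split; lra.
- intros x Hx. apply grid_in in Hx; [|lra]. destruct Hx as [Sx _]. unfold f.
  destruct (classic (A x)) as [Ax|Nx].
  + right. rewrite ind_true by assumption. rewrite Rmult_1_r. split; [assumption|].
    destruct (classic (ball k x0 r x)) as [Bx|Nb].
    * rewrite ind_true by tauto.
      replace (fun i => h ^ k * (1 * x i + 1 * w i) / h ^ k) with (fun i => x i + w i)
        by (extensionality i; field; lra).
      apply Hball.
      -- intros j Hj. rewrite Sx, Sw by assumption. ring.
      (* Writing [x + w - x0] as the midpoint of [2 (x - x0)] and [2 w] bounds its square norm by
         [2 r^2 + 2 r^2 = rho^2], strictly. *)
      -- rewrite (nsq_ext k _ (fun i => 1 / 2 * (2 * (x i - x0 i)) + (1 - 1 / 2) * (2 * w i)))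
           by (intros; field).
         eapply Rle_lt_trans; [apply nsq_convex; lra|]. rewrite !nsq_scal.
         unfold ball in Bx. unfold r in Bx, Hw. nra.
    * rewrite ind_false by tauto.
      replace (fun i => h ^ k * (1 * x i + 0 * w i) / h ^ k) with x
        by (extensionality i; field; lra). assumption.
  + left. intros o. rewrite (ind_false A), (ind_false (fun x => A x /\ ball k x0 r x)) by tauto.
    destruct o; ring.
- exfalso. specialize (K None). rewrite Tot in K. lra.
- rewrite Tot in K2, K1.
  replace y with (fun i => lsum (grid k L h) (fun x => f x (Some i)) / W); [assumption|].
  extensionality i. rewrite Tot. field. lra.
Qed.

(** * Centered log-concave functions on the plane *)

Lemma qconcave_weaken B B' M g : qconcave B M g -> B <= B' -> qconcave B' M g.
Proof.
intros [U1 [U2 U3]] H. split; [assumption|split; [|assumption]].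
intros x Hx. specialize (U2 x Hx). lra.
Qed.

Lemma log_concave_qconcave B M g : (forall x, 0 <= g x <= M) -> (forall x, g x <> 0 -> Rabs x <= B) ->
  (forall l x y, 0 <= l <= 1 -> 0 < g x -> 0 < g y -> geomean l (g x) (g y) <= g (l * x + (1 - l) * y)) ->
  qconcave B M g.
Proof.
intros H1 H2 H3. split; [assumption|split; [assumption|]].
intros x y z Hxyz.
assert (Px := H1 x). assert (Py := H1 y). assert (Pz := H1 z).
destruct (Req_dec (g x) 0) as [Ex|Ex]; [eapply Rle_trans; [apply Rmin_l|lra]|].
destruct (Req_dec (g z) 0) as [Ez|Ez]; [eapply Rle_trans; [apply Rmin_r|lra]|].
destruct (Req_dec x z) as [E|E]; [replace y with x by lra; apply Rmin_l|].
set (l := (z - y) / (z - x)).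
assert (El : l * (z - x) = z - y) by (unfold l; field; lra).
assert (Hl : 0 <= l <= 1).
{ split; [apply Rle_mult_inv_pos; lra|]. apply Rmult_le_reg_r with (z - x); lra. }
eapply Rle_trans; [apply (geomean_min l); lra|].
replace y with (l * x + (1 - l) * z) by lra. apply H3; lra.
Qed.

Lemma lsum_list_prod A B (l : list A) (l' : list B) f :
  lsum (list_prod l l') f = lsum l (fun x => lsum l' (fun y => f (x, y))).
Proof.
induction l as [|a l IH]; [reflexivity|].
simpl list_prod. rewrite lsum_app, lsum_map, IH. reflexivity.
Qed.

Definition sum2 (L : nat) (h : R) (f : R -> R -> R) : R :=
  sum1 0 h L (fun s => sum1 0 h L (fun t => f s t)).

Lemma sum2_list L h f :
  sum2 L h f = h * h * lsum (list_prod (pts 0 h L) (pts 0 h L)) (fun p => f (fst p) (snd p)).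
Proof. unfold sum2, sum1. rewrite lsum_list_prod, lsum_scal. simpl. ring. Qed.

Lemma sum2_le L h f g : 0 < h -> (forall s t, f s t <= g s t) -> sum2 L h f <= sum2 L h g.
Proof.
intros Hh H. rewrite !sum2_list. apply Rmult_le_compat_l; [nra|]. apply lsum_le. auto.
Qed.

Lemma sum2_cv (B : nat) M M' F :
  (forall s, qconcave (INR B) M (fun t => F s t)) -> qconcave (INR B) M' (fun s => qint (fun t => F s t)) ->
  Un_cv (fun N => sum2 (B * (N + 1)) (mesh N) F) (qint (fun s => qint (fun t => F s t))).
Proof.
intros U U'. apply Un_cv_rate with ((2 * INR B + 1) * M + M'). intros N.
assert (Hh := mesh_bounds N). assert (HL := mesh_cover B N).
set (h := mesh N) in *. set (L := (B * (N + 1))%nat) in *.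
assert (A1 := qint_approx0 _ _ _ h L U' ltac:(lra) ltac:(lra)).
assert (HM := qconcave_M _ _ _ (U 0)).
assert (A2 : Rabs (sum2 L h F - sum1 0 h L (fun s => qint (fun t => F s t))) <= (2 * INR B + 1) * M * h).
{ unfold sum2. unfold sum1 at 1 3. rewrite <- Rmult_minus_distr_l, <- lsum_minus.
  rewrite Rabs_mult, (Rabs_pos_eq h) by lra.
  eapply Rle_trans; [apply Rmult_le_compat_l; [lra|apply lsum_abs]|].
  eapply Rle_trans; [apply Rmult_le_compat_l; [lra|]; apply (lsum_le _ _ _ (fun _ => h * M))|].
  - intros s _. apply (qint_approx0 _ _ _ h L (U s)); lra.
  - rewrite lsum_const, length_pts, plus_INR, mult_INR. change (INR 2) with 2. change (INR 1) with 1.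
    transitivity ((2 * INR B + h) * (h * M)); [right; rewrite <- HL; ring|].
    assert (0 <= h * M) by (apply Rmult_le_pos; lra). nra. }
apply Rabs_le_inv in A1. apply Rabs_le_inv in A2. apply Rabs_le. lra.
Qed.

Lemma Un_cv_le_eventually u v a b : Un_cv u a -> Un_cv v b ->
  (exists N0, forall N, (N >= N0)%nat -> u N <= v N) -> a <= b.
Proof.
intros Hu Hv [N0 H]. apply le_epsilon. intros eps He.
destruct (Hu (eps / 2) ltac:(lra)) as [N1 H1]. destruct (Hv (eps / 2) ltac:(lra)) as [N2 H2].
set (N := max N0 (max N1 N2)).
specialize (H N ltac:(lia)). specialize (H1 N ltac:(lia)). specialize (H2 N ltac:(lia)).
unfold Rdist in *. apply Rabs_def2 in H1. apply Rabs_def2 in H2. lra.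
Qed.

Lemma jensen_log F (l : list (R * R)) :
  (forall s t, 0 <= F s t) ->
  (forall c s t s' t', 0 <= c <= 1 -> 0 < F s t -> 0 < F s' t' ->
     geomean c (F s t) (F s' t') <= F (c * s + (1 - c) * s') (c * t + (1 - c) * t')) ->
  let W := lsum l (fun p => F (fst p) (snd p)) in
  0 < W ->
  let c1 := lsum l (fun p => F (fst p) (snd p) * fst p) / W in
  let c2 := lsum l (fun p => F (fst p) (snd p) * snd p) / W in
  0 < F c1 c2 /\
  lsum l (fun p => F (fst p) (snd p) * ln (F (fst p) (snd p))) <= W * ln (F c1 c2).
Proof.
intros F0 FC W HW c1 c2.
(* The components are mass, the two first moments, and the sum of F ln F. The cone states Jensen's
   inequality at the barycentre; its zero element absorbs the points where F = 0. *)
set (f := fun (p : R * R) (i : nat) => F (fst p) (snd p) * match i with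
  | O => 1 | 1%nat => fst p | 2%nat => snd p | _ => ln (F (fst p) (snd p)) end).
assert (K := lsum_cone (R * R) nat (fun a => (forall i, a i = 0) \/
  (0 < a 0%nat /\ 0 < F (a 1%nat / a 0%nat) (a 2%nat / a 0%nat) /\
   a 3%nat <= a 0%nat * ln (F (a 1%nat / a 0%nat) (a 2%nat / a 0%nat)))) l f).
cbv beta in K.
assert (E : lsum l (fun p => f p 0%nat) = W).
{ apply lsum_ext. intros; unfold f; ring. }
destruct K as [K|K].
- left. reflexivity.
- intros a b [Ha|[Ha1 [Ha2 Ha3]]] [Hb|[Hb1 [Hb2 Hb3]]].
  + left. intros i. rewrite Ha, Hb. ring.
  + right. rewrite !Ha, !Rplus_0_l. auto.
  + right. rewrite !Hb, !Rplus_0_r. auto.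
  + right. split; [lra|].
    set (c := a 0%nat / (a 0%nat + b 0%nat)).
    assert (Hc : c * (a 0%nat + b 0%nat) = a 0%nat) by (unfold c; field; lra).
    assert (Hc0 : 0 <= c) by (apply Rle_mult_inv_pos; lra).
    assert (Hc1 : c <= 1) by nra.
    assert (Q := FC c _ _ _ _ (conj Hc0 Hc1) Ha2 Hb2).
    replace (c * (a 1%nat / a 0%nat) + (1 - c) * (b 1%nat / b 0%nat))
      with ((a 1%nat + b 1%nat) / (a 0%nat + b 0%nat)) in Q by (unfold c; field; lra).
    replace (c * (a 2%nat / a 0%nat) + (1 - c) * (b 2%nat / b 0%nat))
      with ((a 2%nat + b 2%nat) / (a 0%nat + b 0%nat)) in Q by (unfold c; field; lra).
    assert (Q' := ln_le_compat _ _ (geomean_pos _ _ _) Q). rewrite ln_geomean in Q'.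
    split; [eapply Rlt_le_trans; [apply geomean_pos|exact Q]|].
    eapply Rle_trans; [apply Rplus_le_compat; [exact Ha3|exact Hb3]|].
    eapply Rle_trans; [|apply Rmult_le_compat_l; [lra|exact Q']].
    right. set (x := ln _). set (y := ln _). unfold c. field. lra.
- intros [s t] _. unfold f. simpl fst. simpl snd. specialize (F0 s t).
  destruct (Req_dec (F s t) 0) as [Z|Z].
  + left. intros i. rewrite Z. ring.
  + right. rewrite Rmult_1_r.
    replace (F s t * s / F s t) with s by (field; lra).
    replace (F s t * t / F s t) with t by (field; lra). repeat split; lra.
- exfalso. specialize (K 0%nat). rewrite E in K. lra.
- rewrite E in K. exact (proj2 K).
Qed.


(** Halving each variable doubles each integral, whence the 4. The support grows to
    [2 * B + Rabs p <= 3 * B] in each direction, which is why grids of half-width [3 * B] appear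
    from here on. *)
Lemma half_shift_cv (B : nat) M F p1 p2 :
  (forall s, qconcave (INR B) M (fun t => F s t)) ->
  qconcave (INR B) ((2 * INR B + 2) * M) (fun s => qint (fun t => F s t)) ->
  Rabs p1 <= INR B -> Rabs p2 <= INR B ->
  Un_cv (fun N => sum2 (3 * B * (N + 1)) (mesh N) (fun s t => F (p1 / 2 + 1 / 2 * s) (p2 / 2 + 1 / 2 * t)))
    (4 * qint (fun s => qint (fun t => F s t))).
Proof.
intros U U' H1 H2.
assert (R3 : INR (3 * B) = 3 * INR B) by (rewrite mult_INR; simpl; ring).
assert (Hp : forall p, Rabs p <= INR B -> (INR B + Rabs (p / 2)) / (1 / 2) <= INR (3 * B)).
{ intros p Hp. rewrite R3. unfold Rdiv at 2. rewrite Rabs_mult, (Rabs_pos_eq (/ 2)) by lra. lra. }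
assert (E : forall s, qint (fun t => F (p1 / 2 + 1 / 2 * s) (p2 / 2 + 1 / 2 * t))
  = 2 * qint (fun t => F (p1 / 2 + 1 / 2 * s) t)).
{ intros s. rewrite (qint_affine _ _ _ (p2 / 2) (1 / 2) (U (p1 / 2 + 1 / 2 * s))) by lra. field. }
assert (Ua := qconcave_affine _ _ _ (p1 / 2) (1 / 2) U' ltac:(lra)).
replace (4 * qint (fun s => qint (fun t => F s t)))
  with (qint (fun s => qint (fun t => F (p1 / 2 + 1 / 2 * s) (p2 / 2 + 1 / 2 * t)))).
- apply (sum2_cv (3 * B) M (2 * ((2 * INR B + 2) * M))).
  + intros s. apply (qconcave_weaken _ _ _ _ (qconcave_affine _ _ _ (p2 / 2) (1 / 2) (U _) ltac:(lra))). auto.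
  + replace (fun s => qint (fun t => F (p1 / 2 + 1 / 2 * s) (p2 / 2 + 1 / 2 * t)))
      with (fun s => 2 * qint (fun t => F (p1 / 2 + 1 / 2 * s) t)).
    * apply (qconcave_scal _ _ _ 2 (qconcave_weaken _ _ _ _ Ua (Hp p1 H1))). lra.
    * extensionality s. symmetry. apply E.
- rewrite (qint_ext _ _ E), (qint_scal _ _ _ 2 Ua) by lra.
  rewrite (qint_affine _ _ _ (p1 / 2) (1 / 2) U') by lra. field.
Qed.


Lemma marginal_qconcave (B : nat) M F :
  (forall s t, 0 <= F s t <= M) ->
  (forall s t, F s t <> 0 -> Rabs s <= INR B /\ Rabs t <= INR B) ->
  (forall c s t s' t', 0 <= c <= 1 -> 0 < F s t -> 0 < F s' t' ->
     geomean c (F s t) (F s' t') <= F (c * s + (1 - c) * s') (c * t + (1 - c) * t')) ->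
  (forall s, qconcave (INR B) M (fun t => F s t)) /\
  (forall t, qconcave (INR B) M (fun s => F s t)) /\
  qconcave (INR B) ((2 * INR B + 2) * M) (fun s => qint (fun t => F s t)).
Proof.
intros HM HB HC.
assert (U1 : forall s, qconcave (INR B) M (fun t => F s t)).
{ intros s. apply log_concave_qconcave; [auto|intros x Hx; apply (HB s x Hx)|].
  intros l x y Hl Hx Hy. assert (Q := HC l s x s y Hl Hx Hy).
  replace (l * s + (1 - l) * s) with s in Q by ring. exact Q. }
split; [assumption|split].
- intros t. apply log_concave_qconcave; [auto|intros x Hx; apply (HB x t Hx)|].
  intros l x y Hl Hx Hy. assert (Q := HC l x t y t Hl Hx Hy).
  replace (l * t + (1 - l) * t) with t in Q by ring. exact Q.
- apply log_concave_qconcave.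
  + intros s. split; [apply (qint_nonneg _ _ _ (U1 s))|apply (qint_upper _ _ _ (U1 s))].
  + intros s Hs. apply Rnot_lt_le. intros Hlt. apply Hs.
    rewrite (qint_ext _ (fun _ => 0)); [apply qint_zero|]. intros t.
    apply NNPP. intros Hn. apply HB in Hn. lra.
  + intros l x y Hl Hx Hy. apply (qint_PL _ _ _ _ _ _ _ _ _ _ (U1 x) (U1 y) (U1 _) Hl); auto.
Qed.

(* Jensen gives [ln (F 0) >= (int F ln F) / (int F)], while midpoint log-concavity with [p] bounds
   [F ln (F p / F) <= 2 sqrt (F p * F) <= 2 F ((p + .) / 2)], whose integral is [8 \int F]. *)
Lemma centered_log_concave_max (B : nat) M F eta e0 :
  (forall s t, 0 <= F s t <= M) ->
  (forall s t, F s t <> 0 -> Rabs s <= INR B /\ Rabs t <= INR B) ->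
  (forall c s t s' t', 0 <= c <= 1 -> 0 < F s t -> 0 < F s' t' ->
     geomean c (F s t) (F s' t') <= F (c * s + (1 - c) * s') (c * t + (1 - c) * t')) ->
  0 < eta -> 0 < e0 -> (forall s t, Rabs s <= eta -> Rabs t <= eta -> e0 <= F s t) ->
  Un_cv (fun N => sum2 (3 * B * (N + 1)) (mesh N) (fun s t => F s t * s)) 0 ->
  Un_cv (fun N => sum2 (3 * B * (N + 1)) (mesh N) (fun s t => F s t * t)) 0 ->
  0 < qint (fun s => qint (fun t => F s t)) /\ forall p1 p2, F p1 p2 <= exp 8 * F 0 0.
Proof.
intros HM HB HC Heta He0 Hball C1 C2.
destruct (marginal_qconcave B M F HM HB HC) as [U1 [_ U2]].
set (V2 := qint (fun s => qint (fun t => F s t))).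
assert (HV2 : 0 < V2).
{ apply Rlt_le_trans with (e0 * (eta - - eta) * (eta - - eta)).
  - apply Rmult_lt_0_compat; [apply Rmult_lt_0_compat|]; lra.
  - apply (qint_lower _ _ _ _ _ _ U2); [lra|apply Rmult_le_pos; lra|].
    intros s Hs. apply (qint_lower _ _ _ _ _ _ (U1 s)); [lra|lra|].
    intros t Ht. apply Hball; apply Rabs_le; lra. }
split; [assumption|]. intros p1 p2.
assert (F00 : 0 < F 0 0).
{ eapply Rlt_le_trans; [apply He0|]. apply Hball; rewrite Rabs_R0; lra. }
assert (Hexp := exp_pos 8).
destruct (Req_dec (F p1 p2) 0) as [Z|Z]; [rewrite Z; apply Rmult_le_pos; lra|].
assert (Fp : 0 < F p1 p2) by (specialize (HM p1 p2); lra).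
destruct (HB _ _ Z) as [Bp1 Bp2].
assert (R3 : INR (3 * B) = 3 * INR B) by (rewrite mult_INR; simpl; ring).
assert (PB := pos_INR B).
assert (CW : Un_cv (fun N => sum2 (3 * B * (N + 1)) (mesh N) F) V2).
{ apply (sum2_cv (3 * B) M ((2 * INR B + 2) * M)).
  - intros s. apply (qconcave_weaken _ _ _ _ (U1 s)). lra.
  - apply (qconcave_weaken _ _ _ _ U2). lra. }
assert (CP := half_shift_cv B M F p1 p2 U1 U2 Bp1 Bp2). fold V2 in CP.
(* [mu] governs the weight [mu / (1 + mu)] given to the neighbourhood of the origin; it is sent to 0
   at the end by [le_of_small]. *)
assert (Main : forall mu, 0 < mu <= 1 ->
  ln (F p1 p2) <= (ln (F 0 0) + 8) + (ln (F 0 0) - ln e0) * mu).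
{ intros mu Hmu.
  assert (Lim : (ln (F p1 p2) - (1 + mu) * ln (F 0 0) + mu * ln e0) * V2 <= 2 * (4 * V2)).
  2:{ apply Rmult_le_reg_r with V2; [assumption|]. nra. }
  apply (Un_cv_le_eventually _ _ _ _ (Un_cv_scal _ _ _ CW) (Un_cv_scal _ _ 2 CP)).
  assert (Hd : 0 < V2 / 2 * (mu * eta)) by (apply Rmult_lt_0_compat; nra).
  destruct (CW (V2 / 2) ltac:(lra)) as [N1 H1].
  destruct (C1 _ Hd) as [N2 H2]. destruct (C2 _ Hd) as [N3 H3].
  exists (max N1 (max N2 N3)). intros N HN.
  specialize (H1 N ltac:(lia)). specialize (H2 N ltac:(lia)). specialize (H3 N ltac:(lia)).
  unfold Rdist in H1, H2, H3. rewrite Rminus_0_r in H2, H3. apply Rabs_def2 in H1.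
  assert (Hh := mesh_bounds N). set (h := mesh N) in *. set (L := (3 * B * (N + 1))%nat) in *.
  rewrite sum2_list in *. rewrite (sum2_list L h (fun s t => F (p1 / 2 + 1 / 2 * s) (p2 / 2 + 1 / 2 * t))).
  set (l := list_prod (pts 0 h L) (pts 0 h L)) in *.
  assert (Hhh : 0 < h * h) by nra.
  assert (JL := jensen_log F l (fun s t => proj1 (HM s t)) HC). cbv zeta in JL. cbv beta in H2, H3.
  set (W := lsum l (fun p => F (fst p) (snd p))) in *.
  assert (HW : 0 < W) by (apply Rmult_lt_reg_l with (h * h); lra).
  specialize (JL HW).
  set (X1 := lsum l (fun p => F (fst p) (snd p) * fst p)) in *.
  set (X2 := lsum l (fun p => F (fst p) (snd p) * snd p)) in *.
  set (E := lsum l (fun p => F (fst p) (snd p) * ln (F (fst p) (snd p)))) in *.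
  destruct JL as [JL1 JL2].
  (* The discrete centroid is within [mu * eta] of 0 in each coordinate, so its multiple by [- / mu]
     is still where F >= [e0], and 0 lies on the segment between the two. *)
  assert (Hc : forall X, Rabs (h * h * X) < V2 / 2 * (mu * eta) -> Rabs (- / mu * (X / W)) <= eta).
  { intros X HX. rewrite Rabs_mult in HX. rewrite (Rabs_pos_eq (h * h)) in HX by lra.
    unfold Rdiv. rewrite !Rabs_mult, Rabs_Ropp.
    assert (0 < / mu) by (apply Rinv_0_lt_compat; lra).
    assert (0 < / W) by (apply Rinv_0_lt_compat; lra).
    rewrite (Rabs_pos_eq (/ mu)), (Rabs_pos_eq (/ W)) by lra.
    apply Rmult_le_reg_l with (h * h * W * mu); [repeat apply Rmult_lt_0_compat; lra|].
    replace (h * h * W * mu * (/ mu * (Rabs X * / W))) with (h * h * Rabs X) by (field; lra).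
    assert (V2 / 2 * (mu * eta) <= h * h * W * (mu * eta)) by (apply Rmult_le_compat_r; nra). lra. }
  assert (Fc : e0 <= F (- / mu * (X1 / W)) (- / mu * (X2 / W))) by (apply Hball; apply Hc; assumption).
  assert (Hlam : 0 <= / (1 + mu) <= 1).
  { assert (0 < / (1 + mu)) by (apply Rinv_0_lt_compat; lra).
    assert (/ (1 + mu) * (1 + mu) = 1) by (field; lra). nra. }
  assert (Q := HC (/ (1 + mu)) (X1 / W) (X2 / W) _ _ Hlam JL1 (Rlt_le_trans _ _ _ He0 Fc)).
  replace (/ (1 + mu) * (X1 / W) + (1 - / (1 + mu)) * (- / mu * (X1 / W))) with 0 in Q by (field; lra).
  replace (/ (1 + mu) * (X2 / W) + (1 - / (1 + mu)) * (- / mu * (X2 / W))) with 0 in Q by (field; lra).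
  assert (Q' := ln_le_compat _ _ (geomean_pos _ _ _) Q). rewrite ln_geomean in Q'.
  assert (Fc' := ln_le_compat _ _ He0 Fc).
  set (y := ln (F (- / mu * (X1 / W)) _)) in *. set (x := ln (F (X1 / W) (X2 / W))) in *.
  assert (Usc : x + mu * ln e0 <= (1 + mu) * ln (F 0 0)).
  { apply Rmult_le_compat_l with (r := 1 + mu) in Q'; [|lra].
    replace ((1 + mu) * (/ (1 + mu) * x + (1 - / (1 + mu)) * y)) with (x + mu * y) in Q' by (field; lra).
    nra. }
  assert (Pt : W * ln (F p1 p2) - E <=
    2 * lsum l (fun p => F (p1 / 2 + 1 / 2 * fst p) (p2 / 2 + 1 / 2 * snd p))).
  { unfold W, E. rewrite (Rmult_comm (lsum _ _)), <- !lsum_scal, <- lsum_minus.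
    apply lsum_le. intros [s t] _. simpl fst. simpl snd.
    destruct (Req_dec (F s t) 0) as [Zs|Zs].
    - rewrite Zs. rewrite Rmult_0_r, Rmult_0_l.
      assert (K := HM (p1 / 2 + 1 / 2 * s) (p2 / 2 + 1 / 2 * t)). lra.
    - assert (Fs : 0 < F s t) by (specialize (HM s t); lra).
      assert (K := HC (1 / 2) p1 p2 s t ltac:(lra) Fp Fs).
      replace (1 / 2 * p1 + (1 - 1 / 2) * s) with (p1 / 2 + 1 / 2 * s) in K by field.
      replace (1 / 2 * p2 + (1 - 1 / 2) * t) with (p2 / 2 + 1 / 2 * t) in K by field.
      set (u := ln (F p1 p2) - ln (F s t)).
      (* The geometric mean equals F exp (u / 2) >= F (1 + u / 2), so F u is at most twice the value
         of F at the midpoint. *)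
      assert (G : geomean (1 / 2) (F p1 p2) (F s t) = F s t * exp (u / 2)).
      { unfold geomean. rewrite <- (exp_ln (F s t)) at 2 by assumption. rewrite <- exp_plus.
        f_equal. unfold u. field. }
      rewrite G in K. assert (I := exp_ineq1_le (u / 2)).
      assert (F s t * (1 + u / 2) <= F s t * exp (u / 2)) by (apply Rmult_le_compat_l; lra).
      unfold u in *. nra. }
  assert (W * x <= W * ((1 + mu) * ln (F 0 0) - mu * ln e0)) by (apply Rmult_le_compat_l; lra).
  set (P := lsum l (fun p => F (p1 / 2 + 1 / 2 * fst p) (p2 / 2 + 1 / 2 * snd p))) in *.
  assert (h * h * (W * (ln (F p1 p2) - (1 + mu) * ln (F 0 0) + mu * ln e0)) <= h * h * (2 * P))
    by (apply Rmult_le_compat_l; lra).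
  lra. }
apply le_of_small in Main.
rewrite <- (exp_ln (F p1 p2)) by assumption. rewrite <- (exp_ln (F 0 0)) at 1 by assumption.
rewrite <- exp_plus. apply exp_le_compat. lra.
Qed.

Lemma planar_inequality (B : nat) M F eta e0 :
  (forall s t, 0 <= F s t <= M) ->
  (forall s t, F s t <> 0 -> Rabs s <= INR B /\ Rabs t <= INR B) ->
  (forall c s t s' t', 0 <= c <= 1 -> 0 < F s t -> 0 < F s' t' ->
     geomean c (F s t) (F s' t') <= F (c * s + (1 - c) * s') (c * t + (1 - c) * t')) ->
  0 < eta -> 0 < e0 -> (forall s t, Rabs s <= eta -> Rabs t <= eta -> e0 <= F s t) ->
  Un_cv (fun N => sum2 (3 * B * (N + 1)) (mesh N) (fun s t => F s t * s)) 0 ->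
  Un_cv (fun N => sum2 (3 * B * (N + 1)) (mesh N) (fun s t => F s t * t)) 0 ->
  qint (fun t => F 0 t) * qint (fun s => F s 0) <= 4 * exp 8 * F 0 0 * qint (fun s => qint (fun t => F s t)).
Proof.
intros HM HB HC Heta He0 Hball C1 C2.
destruct (centered_log_concave_max B M F eta e0 HM HB HC Heta He0 Hball C1 C2) as [HV2 Hmax].
destruct (marginal_qconcave B M F HM HB HC) as [U1 [U1' U2]].
set (V2 := qint (fun s => qint (fun t => F s t))) in *.
assert (F00 : 0 < F 0 0).
{ eapply Rlt_le_trans; [apply He0|]. apply Hball; rewrite Rabs_R0; lra. }
set (m := exp 8 * F 0 0). assert (Hm : 0 < m) by (apply Rmult_lt_0_compat; [apply exp_pos|assumption]).
assert (PB := pos_INR B).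
assert (R3 : INR (3 * B) = 3 * INR B) by (rewrite mult_INR; simpl; ring).
assert (CP := half_shift_cv B M F 0 0 U1 U2). rewrite Rabs_R0 in CP. specialize (CP PB PB).
assert (Cax : forall g, qconcave (INR B) M g ->
  Un_cv (fun N => sum1 0 (mesh N) (3 * B * (N + 1)) g) (qint g)).
{ intros g U. apply Un_cv_rate with M. intros N. rewrite Rmult_comm.
  apply (qint_approx0 (INR B)); [assumption|apply mesh_bounds|]. rewrite mesh_cover. lra. }
assert (CC := CV_mult _ _ _ _ (Cax _ (U1 0)) (Cax _ (U1' 0))).
assert (Main : / m * (qint (fun t => F 0 t) * qint (fun s => F s 0)) <= 4 * V2).
2:{ apply Rmult_le_compat_l with (r := m) in Main; [|lra].
    rewrite <- Rmult_assoc, Rinv_r, Rmult_1_l in Main by lra. unfold m in Main. lra. }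
apply (Un_cv_le_eventually _ _ _ _ (Un_cv_scal _ _ (/ m) CC) CP).
exists 0%nat. intros N _. cbv beta. assert (Hh := mesh_bounds N).
set (h := mesh N) in *. set (L := (3 * B * (N + 1))%nat).
apply Rle_trans with (sum2 L h (fun s t => / m * (F s 0 * F 0 t))).
- right. unfold sum2, sum1.
  rewrite (lsum_ext _ (pts 0 h L) (fun s => h * lsum (pts 0 h L) (fun t => / m * (F s 0 * F 0 t)))
    (fun s => (h * / m * lsum (pts 0 h L) (fun t => F 0 t)) * F s 0)).
  + rewrite lsum_scal. ring.
  + intros s _. rewrite !lsum_scal.
    change (lsum (pts 0 h L) (F 0)) with (lsum (pts 0 h L) (fun t => F 0 t)). ring.
- apply sum2_le; [lra|]. intros s t.
  assert (A1 := HM s 0). assert (A2 := HM 0 t). assert (A3 := HM (0 / 2 + 1 / 2 * s) (0 / 2 + 1 / 2 * t)).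
  destruct (Req_dec (F s 0) 0) as [Z|Z]; [rewrite Z, Rmult_0_l, Rmult_0_r; lra|].
  destruct (Req_dec (F 0 t) 0) as [Z'|Z']; [rewrite Z', !Rmult_0_r; lra|].
  (* The midpoint of [(s, 0)] and [(0, t)] is [(s / 2, t / 2)]. As both values are at most [m],
     their geometric mean dominates [a * b / m]. *)
  assert (K := HC (1 / 2) s 0 0 t ltac:(lra) ltac:(lra) ltac:(lra)).
  replace (1 / 2 * s + (1 - 1 / 2) * 0) with (0 / 2 + 1 / 2 * s) in K by field.
  replace (1 / 2 * 0 + (1 - 1 / 2) * t) with (0 / 2 + 1 / 2 * t) in K by field.
  eapply Rle_trans; [|exact K].
  set (a := F s 0) in *. set (b := F 0 t) in *.
  assert (La := ln_le_compat a m ltac:(lra) (Hmax s 0)).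
  assert (Lb := ln_le_compat b m ltac:(lra) (Hmax 0 t)).
  assert (Eab : / m * (a * b) = exp (- ln m + (ln a + ln b))).
  { rewrite !exp_plus, exp_Ropp, !exp_ln by lra. reflexivity. }
  rewrite Eab. apply exp_le_compat. lra.
Qed.

(** * Sections of a centered convex body *)

(** Two orthonormal bases of the same hyperplane differ by an orthogonal matrix [c] of size [k], so
    the claim reduces to [vol_rotation] inside the hyperplane. *)
Lemma vol_hyperplane_basis n k u b b' A rho Rn : S k = n -> unit_vec n u ->
  orthonormal n k b -> (forall i, (i < k)%nat -> dot n u (b i) = 0) ->
  orthonormal n k b' -> (forall i, (i < k)%nat -> dot n u (b' i) = 0) ->
  convex_set n A -> 0 < rho -> 0 <= Rn ->
  (forall x, supp n x -> nsq n x < rho * rho -> A x) ->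
  (forall x, A x -> nsq n x <= Rn * Rn) ->
  vol k (fun t => A (lincomb k b t)) = vol k (fun t => A (lincomb k b' t)).
Proof.
intros Hk U O H O' H' CA Hrho HRn Hball HRA.
set (c := fun i j => if Nat.ltb j k then dot n (b' i) (b j) else 0).
assert (Ec : forall i, (i < k)%nat -> lincomb k b (c i) = b' i).
{ intros i Hi.
  rewrite <- (complement_complete n k b u (b' i) Hk O U H (proj1 O' i Hi) (H' i Hi)).
  apply lincomb_eq; [|auto]. intros j Hj. unfold c. destruct (Nat.ltb_spec j k); [reflexivity|lia]. }
assert (Oc : orthonormal k k c).
{ split.
  - intros i Hi j Hj. unfold c. destruct (Nat.ltb_spec j k); [lia|reflexivity].
  - intros i j Hi Hj. rewrite <- (dot_lincomb n k b) by assumption. rewrite !Ec by assumption.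
    apply O'; assumption. }
rewrite <- (vol_rotation k c (fun t => A (lincomb k b t)) rho Rn Oc); auto.
- apply vol_ext. intros z _.
  replace (lincomb k b (lincomb k c z)) with (lincomb k b' z); [tauto|].
  extensionality j. unfold lincomb at 1 2.
  rewrite (rsum_ext k (fun i => lincomb k c z i * b i j)
    (fun i => rsum k (fun l => z l * (c l i * b i j)))).
  + rewrite rsum_swap. apply rsum_ext. intros l Hl. rewrite rsum_scal, <- (Ec l Hl). reflexivity.
  + intros i _. unfold lincomb. rewrite Rmult_comm, <- rsum_scal. apply rsum_ext. intros; ring.
- intros x y t Hx Hy Ht. rewrite lincomb_lin. apply CA; assumption.
- intros x _ Hx. apply Hball; [apply lincomb_supp; assumption|]. rewrite nsq_lincomb by assumption. exact Hx.
- intros x Hx. apply HRA in Hx. rewrite nsq_lincomb in Hx by assumption. exact Hx.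
Qed.

Lemma sum2_abs_bound (B L : nat) h f X : 0 < h <= 1 -> h * INR L = INR B -> 0 <= X ->
  (forall s t, Rabs s <= INR B -> Rabs t <= INR B -> Rabs (f s t) <= X) ->
  Rabs (sum2 L h f) <= (2 * INR B + 1) ^ 2 * X.
Proof.
intros Hh HL HX H.
assert (K : forall g Y, 0 <= Y -> (forall s, Rabs s <= INR B -> Rabs (g s) <= Y) ->
  Rabs (sum1 0 h L g) <= (2 * INR B + 1) * Y).
{ intros g Y HY Hg. unfold sum1. rewrite Rabs_mult, (Rabs_pos_eq h) by lra.
  eapply Rle_trans; [apply Rmult_le_compat_l; [lra|apply lsum_abs]|].
  eapply Rle_trans; [apply Rmult_le_compat_l; [lra|]; apply (lsum_le _ _ _ (fun _ => Y))|].
  - intros s Hs. apply Hg. rewrite <- HL. apply pts_bound; [lra|assumption].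
  - rewrite lsum_const, length_pts, plus_INR, mult_INR. change (INR 2) with 2. change (INR 1) with 1.
    transitivity ((2 * INR B + h) * Y); [right; rewrite <- HL; ring|].
    apply Rmult_le_compat_r; lra. }
assert (PB := pos_INR B).
unfold sum2. simpl. rewrite Rmult_1_r, Rmult_assoc. apply K.
- apply Rmult_le_pos; lra.
- intros s Hs. apply K; auto.
Qed.

Lemma gint_sum2 m L h f :
  gint (S (S m)) L h f = sum2 L h (fun s t => gint m L h (fun z => f (upd (upd z m t) (S m) s))).
Proof.
unfold gint, sum2, sum1. rewrite lsum_grid_S.
rewrite (lsum_ext _ (pts 0 h L) _
  (fun s => lsum (pts 0 h L) (fun t => lsum (grid m L h) (fun z => f (upd (upd z m t) (S m) s)))))
  by (intros; apply lsum_grid_S).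
transitivity (h * h * h ^ m * lsum (pts 0 h L) (fun s => lsum (pts 0 h L)
  (fun t => lsum (grid m L h) (fun z => f (upd (upd z m t) (S m) s))))).
- simpl. ring.
- rewrite (lsum_ext _ (pts 0 h L) (fun s => h * lsum _ _) (fun s => h * h ^ m * lsum (pts 0 h L)
  (fun t => lsum (grid m L h) (fun z => f (upd (upd z m t) (S m) s))))).
  + rewrite lsum_scal. ring.
  + intros s _. rewrite lsum_scal. ring.
Qed.

Lemma sum2_minus L h f g : sum2 L h (fun s t => f s t - g s t) = sum2 L h f - sum2 L h g.
Proof. rewrite !sum2_list, lsum_minus. ring. Qed.

(** Summing the lattice first over the fibre replaces each fibre count by a section volume. The
    error of [vol_approx] does not depend on the fibre, so it survives summation over [s] and [t].
    The lemma is applied with [q] equal to either variable. *)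
Lemma moment_of_sections m B A (q : R -> R -> R) :
  convex_in_box (S (S m)) B A -> (forall s t, Rabs s <= INR B -> Rabs t <= INR B -> Rabs (q s t) <= INR B) ->
  Un_cv (fun N => gint (S (S m)) (B * (N + 1)) (mesh N) (fun z => ind A z * q (z (S m)) (z m))) 0 ->
  Un_cv (fun N => sum2 (B * (N + 1)) (mesh N)
    (fun s t => vol m (fun z => A (upd (upd z m t) (S m) s)) * q s t)) 0.
Proof.
intros CB Hq H.
set (F := fun s t => vol m (fun z => A (upd (upd z m t) (S m) s))).
assert (D : Un_cv (fun N => sum2 (B * (N + 1)) (mesh N) (fun s t => F s t * q s t)
  - gint (S (S m)) (B * (N + 1)) (mesh N) (fun z => ind A z * q (z (S m)) (z m))) 0).
{ apply Un_cv_rate with ((2 * INR B + 1) ^ 2 * (vol_error m B * INR B)). intros N.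
  assert (Hh := mesh_bounds N). assert (HL := mesh_cover B N).
  set (h := mesh N) in *. set (L := (B * (N + 1))%nat) in *.
  rewrite Rminus_0_r, gint_sum2, <- sum2_minus.
  assert (PB := pos_INR B). assert (PC := vol_error_nonneg m B).
  eapply Rle_trans; [apply (sum2_abs_bound B L h _ (vol_error m B * h * INR B)); auto|].
  - apply Rmult_le_pos; [apply Rmult_le_pos|]; lra.
  - intros s t Hs Ht.
    replace (gint m L h (fun z => ind A (upd (upd z m t) (S m) s) *
      q (upd (upd z m t) (S m) s (S m)) (upd (upd z m t) (S m) s m)))
      with (q s t * gint m L h (ind (fun z => A (upd (upd z m t) (S m) s)))).
    + rewrite (Rmult_comm (F s t)), <- Rmult_minus_distr_l, Rabs_mult, Rmult_comm.
      apply Rmult_le_compat; try apply Rabs_pos; auto.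
      rewrite Rabs_minus_sym. apply vol_approx; auto.
      apply (convex_in_box_section m B (fun x => A (upd x (S m) s)) t), convex_in_box_section. assumption.
    + rewrite <- gint_scal. apply gint_ext; [lra|]. intros z _.
      rewrite upd_same, upd_other, upd_same by lia. apply Rmult_comm.
  - right. ring. }
assert (E := CV_plus _ _ _ _ D H). rewrite Rplus_0_r in E.
revert E. apply Un_cv_ext. intros N. unfold F. ring.
Qed.

Lemma sections_planar m B A r :
  convex_in_box (S (S m)) B A -> convex_in_box (S (S m)) (3 * B) A -> 0 < r ->
  (forall z, supp (S (S m)) z -> (forall i, (i < S (S m))%nat -> Rabs (z i) <= r) -> A z) ->
  (forall j, (j < S (S m))%nat ->
    Un_cv (fun N => gint (S (S m)) (3 * B * (N + 1)) (mesh N) (fun z => ind A z * z j)) 0) ->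
  let F s t := vol m (fun z => A (upd (upd z m t) (S m) s)) in
  qint (fun t => F 0 t) * qint (fun s => F s 0) <= 4 * exp 8 * F 0 0 * vol (S (S m)) A.
Proof.
intros CB CB3 Hr Hball Hc F.
assert (Csec : forall s t, convex_in_box m B (fun z => A (upd (upd z m t) (S m) s))).
{ intros s t. apply (convex_in_box_section m B (fun x => A (upd x (S m) s)) t).
  apply convex_in_box_section. assumption. }
apply (planar_inequality B ((2 * INR B + 2) ^ m) F r ((2 * r) ^ m)); auto.
- intros s t. apply vol_bound, Csec.
- intros s t Hst.
  assert (P : exists z, A (upd (upd z m t) (S m) s)).
  { apply NNPP. intros N. apply Hst. apply vol_empty. intros z Hz. apply N. exists z. assumption. }
  destruct P as [z Hz]. destruct CB as [_ Bd]. split.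
  + assert (Q := Bd _ Hz (S m) ltac:(lia)). rewrite upd_same in Q. exact Q.
  + assert (Q := Bd _ Hz m ltac:(lia)). rewrite upd_other, upd_same in Q by lia. exact Q.
- intros c s t s' t' Hc' H1 H2. apply (vol_PL m B); auto.
  intros x y Hx Hy. rewrite upd_comb, upd_comb. apply CB; assumption.
- apply pow_lt. lra.
- intros s t Hs Ht. apply (vol_lower m B _ (fun _ => 0)); auto; [lra|].
  intros x Sx Hx. apply Hball; [apply upd_supp, upd_supp; assumption|].
  intros i Hi. unfold upd. destruct (Nat.eqb_spec i (S m)); [assumption|].
  destruct (Nat.eqb_spec i m); [assumption|]. specialize (Hx i ltac:(lia)).
  rewrite Rminus_0_r in Hx. exact Hx.
- apply (moment_of_sections m (3 * B) A (fun s t => s)); auto.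
- apply (moment_of_sections m (3 * B) A (fun s t => t)); auto.
Qed.

Lemma lincomb_snoc_upd m be u v z s t :
  lincomb (S (S m)) (snoc (S m) (snoc m be v) u) (upd (upd z m t) (S m) s)
  = (fun j => lincomb m be z j + t * v j + s * u j).
Proof.
extensionality j. rewrite !lincomb_snoc_S, upd_same, upd_other, upd_same by lia.
f_equal. f_equal. apply rsum_ext. intros i Hi. rewrite !upd_other by lia. reflexivity.
Qed.

Lemma lincomb_snoc_upd1 m be v z t :
  lincomb (S m) (snoc m be v) (upd z m t) = (fun j => lincomb m be z j + t * v j).
Proof.
extensionality j. rewrite !lincomb_snoc_S, upd_same.
f_equal. apply rsum_ext. intros i Hi. rewrite !upd_other by lia. reflexivity.
Qed.

Lemma convex_rotated n k b A : convex_set n A -> convex_set k (fun t => A (lincomb k b t)).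
Proof. intros C x y t Hx Hy Ht. rewrite lincomb_lin. apply C; assumption. Qed.

Theorem mainTheorem4 :
  exists c : R, 0 < c /\
  forall (n : nat) (K : Vec -> Prop) (u v : Vec),
    (3 <= n)%nat ->
    convex_body n K -> centered n K ->
    unit_vec n u -> unit_vec n v -> dot n u v = 0 ->
    forall (bu bv be : nat -> Vec),
      (* bu : orthonormal basis of u^perp *)
      orthonormal n (n - 1) bu ->
      (forall i, (i < n - 1)%nat -> dot n u (bu i) = 0) ->
      (* bv : orthonormal basis of v^perp *)
      orthonormal n (n - 1) bv ->
      (forall i, (i < n - 1)%nat -> dot n v (bv i) = 0) ->
      (* be : orthonormal basis of E_uv = (span{u,v})^perp *)
      orthonormal n (n - 2) be ->
      (forall i, (i < n - 2)%nat -> dot n u (be i) = 0 /\ dot n v (be i) = 0) ->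
      forall Su Sv Se VK : R,
        section_vol (n - 1) bu K Su ->
        section_vol (n - 1) bv K Sv ->
        section_vol (n - 2) be K Se ->
        is_vol n K VK ->
        Su * Sv <= c * Se * VK.
Proof.
exists (4 * exp 8). split; [assert (H := exp_pos 8); lra|].
intros n K u v Hn [KS [CK [_ [[Bd HBd] [x0 [r0 [Hr0 [Sx0 Hx0]]]]]]]] Hcent Uu Uv Huv
  bu bv be Obu Hbu Obv Hbv Obe Hbe Su Sv Se VK HSu HSv HSe HVK.
destruct n as [|[|m]]; [lia|lia|].
replace (S (S m) - 1)%nat with (S m) in * by lia.
replace (S (S m) - 2)%nat with m in * by lia.
apply is_vol_vol in HSu; [|apply (convex_rotated (S (S m))); assumption].
apply is_vol_vol in HSv; [|apply (convex_rotated (S (S m))); assumption].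
apply is_vol_vol in HSe; [|apply (convex_rotated (S (S m))); assumption].
apply is_vol_vol in HVK; [|assumption]. subst Su Sv Se VK.
set (n := S (S m)) in *.
set (Rn := Rmax Bd 0). assert (HRn : 0 <= Rn) by apply Rmax_r.
assert (HRK : forall x, K x -> nsq n x <= Rn * Rn).
{ intros x Hx. apply HBd in Hx. unfold norm in Hx. fold (nsq n x) in Hx.
  assert (P := nsq_nonneg n x). rewrite <- (sqrt_sqrt _ P).
  assert (Q := sqrt_pos (nsq n x)). assert (Bd <= Rn) by apply Rmax_l.
  apply Rmult_le_compat; lra. }
destruct (INR_unbounded (2 * Rn + 2)) as [B HB].
assert (R3 : INR (3 * B) = 3 * INR B) by (rewrite mult_INR; simpl; ring).
assert (CB : convex_in_box n B K).
{ split; [assumption|]. intros x Hx i Hi. apply HRK in Hx.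
  apply (nsq_coord_abs n x i Rn Hi HRn) in Hx. lra. }
(* From here on the origin plays the part of the interior point: rotation arguments and the lower
   bound [e0] both need a ball centred at 0. *)
destruct (centroid_interior n K B x0 r0 CB Hr0 Sx0) as [eta [Heta Hball]]; [|exact Hcent|].
{ intros y Sy Hy. apply Hx0; [assumption|]. unfold dist, norm.
  fold (nsq n (fun i => x0 i - y i)). rewrite nsq_sub_sym.
  rewrite <- (sqrt_square r0) by lra. apply sqrt_lt_1_alt. split; [apply nsq_nonneg|assumption]. }
assert (Ov : orthonormal n (S m) (snoc m be v)).
{ apply orthonormal_snoc; auto. intros i Hi. apply Hbe; assumption. }
assert (Ou : orthonormal n (S m) (snoc m be u)).
{ apply orthonormal_snoc; auto. intros i Hi. apply Hbe; assumption. }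
assert (Hu_v : forall i, (i < S m)%nat -> dot n u (snoc m be v i) = 0).
{ intros i Hi. unfold snoc. destruct (Nat.eqb_spec i m); [assumption|]. apply Hbe. lia. }
assert (Hv_u : forall i, (i < S m)%nat -> dot n v (snoc m be u i) = 0).
{ intros i Hi. unfold snoc. destruct (Nat.eqb_spec i m); [rewrite dot_comm; assumption|].
  apply Hbe. lia. }
(* In this basis [u] carries the outer variable [s] and [v] the next one [t]. Hence [s = 0]
   describes the hyperplane orthogonal to [u], spanned by [be] and [v], and [t = 0] the one
   orthogonal to [v]. *)
set (e := snoc (S m) (snoc m be v) u).
assert (Oe : orthonormal n n e) by (apply orthonormal_snoc; assumption).
set (A := fun z => K (lincomb n e z)).
assert (CA : forall B', Rn <= INR B' -> convex_in_box n B' A).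
{ intros B' HB'. apply (convex_in_box_rotated n n B' e K Rn); assumption. }
assert (Hn0 := pos_INR n).
(* The cube of half-side [eta / (n + 1)] lies in the ball of radius [eta]. *)
set (r := eta / (INR n + 1)). assert (Hr : 0 < r) by (apply Rdiv_lt_0_compat; lra).
assert (Hre : r * (INR n + 1) = eta) by (unfold r; field; lra).
assert (Main := sections_planar m B A r (CA B ltac:(lra)) (CA (3 * B)%nat ltac:(lra)) Hr).
cbv beta zeta in Main.
(* The given bases [bu] and [bv] are exchanged for [be] extended by [v], respectively by [u], so
   that all four volumes become slices of the single set [A]. *)
rewrite (vol_hyperplane_basis n (S m) u bu (snoc m be v) K eta Rn eq_refl
  Uu Obu Hbu Ov Hu_v CK Heta HRn Hball HRK).
rewrite (vol_hyperplane_basis n (S m) v bv (snoc m be u) K eta Rn eq_refl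
  Uv Obv Hbv Ou Hv_u CK Heta HRn Hball HRK).
rewrite <- (vol_rotation n e K eta Rn Oe CK Heta HRn Hball HRK). fold A.
assert (E00 : vol m (fun z => A (upd (upd z m 0) (S m) 0)) = vol m (fun t => K (lincomb m be t))).
{ apply vol_ext. intros z _. unfold A, n, e. rewrite lincomb_snoc_upd.
  replace (fun j => lincomb m be z j + 0 * v j + 0 * u j) with (lincomb m be z); [tauto|].
  extensionality j. ring. }
assert (E0t : qint (fun t => vol m (fun z => A (upd (upd z m t) (S m) 0)))
  = vol (S m) (fun t => K (lincomb (S m) (snoc m be v) t))).
{ simpl vol. apply qint_ext. intros t. apply vol_ext. intros z _. unfold A, n, e.
  rewrite lincomb_snoc_upd, lincomb_snoc_upd1.
  replace (fun j => lincomb m be z j + t * v j + 0 * u j)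
    with (fun j => lincomb m be z j + t * v j); [tauto|]. extensionality j. ring. }
assert (Es0 : qint (fun s => vol m (fun z => A (upd (upd z m 0) (S m) s)))
  = vol (S m) (fun t => K (lincomb (S m) (snoc m be u) t))).
{ simpl vol. apply qint_ext. intros s. apply vol_ext. intros z _. unfold A, n, e.
  rewrite lincomb_snoc_upd, lincomb_snoc_upd1.
  replace (fun j => lincomb m be z j + 0 * v j + s * u j)
    with (fun j => lincomb m be z j + s * u j); [tauto|]. extensionality j. ring. }
rewrite E00, E0t, Es0 in Main. apply Main.
- intros z Sz Hz. unfold A. apply Hball; [apply lincomb_supp; assumption|].
  rewrite nsq_lincomb by assumption.
  apply Rle_lt_trans with (rsum n (fun _ => r * r)).
  + apply rsum_le. intros i Hi. specialize (Hz i Hi). apply Rabs_le_inv in Hz. nra.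
  + rewrite rsum_const, <- Hre. nra.
- intros j Hj. apply (centroid_rotated n e K eta Rn (3 * B)); auto. lra.
Qed.
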